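(* Let $D$ be a connection on the spinor bundle $S$ over $M$, and let $\phi,\psi\in\Gamma S$ be parallel with respect to the associated connection $D^C$, i.e. $D^C\phi=D^C\psi=0$. Then the vector field $\{\phi,\psi\}=2C_1(\phi\otimes\psi)$ is a Killing vector field of $(M,g)$ if the symmetric part of $\hat D\gamma:\mathfrak X(M)\otimes\mathfrak X(M)\to\Gamma\,\mathrm{End}(S)$ acts trivially on the parallel spinors, i.e. if $$\big((\hat D_X\gamma)(Y)+(\hat D_Y\gamma)(X)\big)\phi=\big((\hat D_X\gamma)(Y)+(\hat D_Y\gamma)(X)\big)\psi=0\quad\text{for all }X,Y\in\mathfrak X(M).$$ In this case, with $\mathcal T$ the torsion of $D$, $$\nabla_\mu\{\phi,\psi\}_\nu=C(\phi,\mathcal T_{\mu\nu}\psi).$$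
   Context: $(M,g)$ is a (pseudo-)Riemannian spin manifold with Levi-Civita connection $\nabla$ (also denoting the induced connection on $S$), spinor bundle $S$, and Clifford multiplication $\gamma:\mathfrak X(M)\to\Gamma\,\mathrm{End}(S)$, $\gamma(X)\gamma(Y)+\gamma(Y)\gamma(X)=-2g(X,Y)$; $\gamma_\mu=\gamma(e_\mu)$ for a local frame $\{e_\mu\}$. $C$ is a fixed charge conjugation: a non-degenerate spin-invariant bilinear form on $S$ ($\nabla$-parallel, and symmetric or skew). $C_1(\phi\otimes\psi)$ is the vector field (possibly complex) whose components, with index lowered by $g$, are $C(\phi,\gamma_\mu\psi)$. For $\Phi\in\mathrm{End}(S)$ define $\Phi^C$ by $C(\Phi^C\eta,\xi)=C(\eta,\Phi\xi)$. For a connection $D$ on $S$ put $\mathcal A:=D-\nabla\in\Omega^1(M)\otimes\Gamma\,\mathrm{End}(S)$ and $D^C:=\nabla-\mathcal A^C$. The connection $\hat D$ on $\mathrm{End}(S)$-valued tensors $\Phi$ on $M$ is given by $(\hat D_Z\Phi)(X)\xi=D_Z(\Phi(X)\xi)-\Phi(\nabla_ZX)\xi-\Phi(X)D^C_Z\xi$, where $X$ stands for the tensor arguments. In particular $(\hat D_Z\gamma)(X)\xi=D_Z(\gamma(X)\xi)-\gamma(\nabla_ZX)\xi-\gamma(X)D^C_Z\xi$. The torsion of $D$ is $\mathcal T\in\Omega^2(M)\otimes\Gamma\,\mathrm{End}(S)$, $\mathcal T(X,Y)=(\hat D_X\gamma)(Y)-(\hat D_Y\gamma)(X)$, and $\mathcal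 T_{\mu\nu}=\mathcal T(e_\mu,e_\nu)$. *)

(* Defs.v *)
From HB Require Import structures.
From mathcomp Require Import all_boot all_order all_algebra.
From mathcomp Require Import complex.
From mathcomp Require Import all_classical all_reals all_analysis.
Set Implicit Arguments.
Unset Strict Implicit.
Unset Printing Implicit Defensive.
Import Order.TTheory GRing.Theory Num.Theory.
Import numFieldNormedType.Exports.
Local Open Scope classical_set_scope.
Local Open Scope complex_scope.
Local Open Scope ring_scope.

Section Manifolds.
Variables (R : realType) (n : nat).

Fixpoint Ck (k : nat) (O : set 'rV[R]_n) (f : 'rV[R]_n -> R) : Prop :=
  (forall x, O x -> {for x, continuous f}) /\
  match k with
  | 0%N => True
  | k'.+1 => forall i : 'I_n,
      (forall x, O x -> derivable f x (delta_mx 0 i)) /\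
      Ck k' O (fun x => 'D_(delta_mx 0 i) f x)
  end.

Definition smooth_on (O : set 'rV[R]_n) (f : 'rV[R]_n -> R) : Prop :=
  forall k, Ck k O f.

Record manifold := Manifold {
  carrier :> topologicalType;
  mfd_hausdorff : hausdorff_space carrier;
  mfd_countable : @second_countable carrier;
  chart : Type;
  chart_dom : chart -> set carrier;
  chart_map : chart -> carrier -> 'rV[R]_n;
  chart_inv : chart -> 'rV[R]_n -> carrier;
  chart_dom_open : forall c, open (chart_dom c);
  chart_cover : forall x, exists c, chart_dom c x;
  chart_img_open : forall c, open (chart_map c @` chart_dom c);
  chart_mapK : forall c x, chart_dom c x -> chart_inv c (chart_map c x) = x;
  chart_map_cont : forall c x, chart_dom c x ->
    {for x, continuous (chart_map c)};
  chart_inv_cont : forall c x, chart_dom c x ->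
    {for chart_map c x, continuous (chart_inv c)};
  chart_compat : forall c d (j : 'I_n),
    smooth_on (chart_map c @` (chart_dom c `&` chart_dom d))
      (fun z => chart_map d (chart_inv c z) 0 j)
}.

End Manifolds.

Section Tangent.
Variables (R : realType) (n : nat) (M : manifold R n).

(* Smooth on a neighbourhood of [x]; [f] is arbitrary elsewhere. *)
Definition smooth_at (x : M) (f : M -> R) : Prop :=
  exists W : set M, [/\ open W, W x &
    forall c, smooth_on (chart_map c @` (W `&` chart_dom c))
                        (f \o chart_inv c)].

Definition csmooth_at (x : M) (f : M -> R[i]) : Prop :=
  smooth_at x (fun y => complex.Re (f y)) /\
  smooth_at x (fun y => complex.Im (f y)).

(* Tangent vectors at [x] are the derivations at [x] of germs of smooth
   functions.  They are encoded as functionals on all functions; the value on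
   functions not smooth near [x] is normalised to 0, so that Leibniz equality of
   functionals is equality in the tangent space. *)
Definition tvec : Type := (M -> R) -> R^o.

Record tangent (x : M) (v : tvec) : Prop := Tangent {
  tangent_linear : forall (a : R) f h, smooth_at x f -> smooth_at x h ->
    v (fun y => a * f y + h y) = a * v f + v h;
  tangent_leibniz : forall f h, smooth_at x f -> smooth_at x h ->
    v (fun y => f y * h y) = v f * h x + f x * v h;
  tangent_local : forall f h, smooth_at x f -> smooth_at x h ->
    (\forall y \near x, f y = h y) -> v f = v h;
  tangent_norm : forall f, ~ smooth_at x f -> v f = 0
}.

(* Only meaningful for [U] open: sections are total functions with arbitrary
   values outside [U]. *)
Definition vfield (U : set M) (X : M -> tvec) : Prop :=
  (forall x, U x -> tangent x (X x)) /\
  (forall x, U x -> forall f, smooth_at x f -> smooth_at x (fun y => X y f)).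

Definition bracket (X Y : M -> tvec) (x : M) : tvec := fun f =>
  if `[< smooth_at x f >]
  then X x (fun y => Y y f) - Y x (fun y => X y f) else 0.

Definition cderiv (v : tvec) (f : M -> R[i]) : R[i] :=
  v (fun y => complex.Re (f y)) +i* v (fun y => complex.Im (f y)).

(* The complexified tangent space: complex-valued derivations. *)
Definition ctvec : Type := (M -> R) -> R[i].
Definition reT (u : ctvec) : tvec := fun f => complex.Re (u f).
Definition imT (u : ctvec) : tvec := fun f => complex.Im (u f).
Definition ctangent (x : M) (u : ctvec) : Prop :=
  tangent x (reT u) /\ tangent x (imT u).

Record metric := Metric {
  metric_val :> M -> tvec -> tvec -> R;
  metric_linear : forall x (a : R) u v w,
    tangent x u -> tangent x v -> tangent x w ->
    metric_val x (a *: u + v) w = a * metric_val x u w + metric_val x v w;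
  metric_sym : forall x u v, tangent x u -> tangent x v ->
    metric_val x u v = metric_val x v u;
  metric_nondeg : forall x u, tangent x u ->
    (forall v, tangent x v -> metric_val x u v = 0) -> u = 0;
  metric_smooth : forall U X Y, open U -> vfield U X -> vfield U Y ->
    forall x, U x -> smooth_at x (fun y => metric_val y (X y) (Y y))
}.

Variable g : metric.

(* [nab x v Y] is the covariant derivative at [x] of the (locally defined) field
   [Y] in the direction [v]. *)
Record affine_connection (nab : M -> tvec -> (M -> tvec) -> tvec) : Prop :=
  AffineConnection {
  nab_tangent : forall U Y x v, open U -> U x -> vfield U Y -> tangent x v ->
    tangent x (nab x v Y);
  nab_linear : forall U Y x (a : R) v w, open U -> U x -> vfield U Y ->
    tangent x v -> tangent x w ->
    nab x (a *: v + w) Y = a *: nab x v Y + nab x w Y;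
  nab_add : forall U Y Z x v, open U -> U x -> vfield U Y -> vfield U Z ->
    tangent x v -> nab x v (fun y => Y y + Z y) = nab x v Y + nab x v Z;
  nab_leibniz : forall U (f : M -> R) Y x v, open U -> U x ->
    (forall y, U y -> smooth_at y f) -> vfield U Y -> tangent x v ->
    nab x v (fun y => (f y : R) *: Y y) = (v f : R) *: Y x + f x *: nab x v Y;
  nab_local : forall U Y Z x v, open U -> U x -> vfield U Y -> vfield U Z ->
    tangent x v -> (forall y, U y -> Y y = Z y) -> nab x v Y = nab x v Z;
  nab_smooth : forall U X Y, open U -> vfield U X -> vfield U Y ->
    vfield U (fun y => nab y (X y) Y)
}.

Record levi_civita (nab : M -> tvec -> (M -> tvec) -> tvec) : Prop :=
  LeviCivita {
  lc_connection : affine_connection nab;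
  lc_torsion_free : forall U X Y x, open U -> U x -> vfield U X ->
    vfield U Y -> nab x (X x) Y - nab x (Y x) X = bracket X Y x;
  lc_metric : forall U Y Z x v, open U -> U x -> vfield U Y -> vfield U Z ->
    tangent x v ->
    v (fun y => g y (Y y) (Z y)) = g x (nab x v Y) (Z x) + g x (Y x) (nab x v Z)
}.

(* L_K g = 0 *)
Definition killing (K : M -> tvec) : Prop :=
  vfield setT K /\
  forall U X Y x, open U -> U x -> vfield U X -> vfield U Y ->
    K x (fun y => g y (X y) (Y y)) - g x (bracket K X x) (Y x)
      - g x (X x) (bracket K Y x) = 0.

(* L_K g = 0 for complex [K], with L_K extended complex linearly in [K] *)
Definition ckilling (K : M -> ctvec) : Prop :=
  killing (fun x => reT (K x)) /\ killing (fun x => imT (K x)).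

Definition cmetric (x : M) (u : ctvec) (w : tvec) : R[i] :=
  g x (reT u) w +i* g x (imT u) w.

Definition cnabla (nab : M -> tvec -> (M -> tvec) -> tvec)
    (x : M) (v : tvec) (K : M -> ctvec) : ctvec := fun f =>
  nab x v (fun y => reT (K y)) f +i* nab x v (fun y => imT (K y)) f.

End Tangent.

Section CliffordModules.
Variables (R : realType) (n N : nat).
(* [sgn i] is true for the negative directions. *)
Variables (sgn : 'I_n -> bool) (Gam : 'I_n -> 'M[R[i]]_N).

Definition eta (i : 'I_n) : R := (-1) ^+ sgn i.

Definition clifford_relations : Prop := forall i j,
  Gam i *m Gam j + Gam j *m Gam i = ((- 2 * eta i *+ (i == j))%:C)%:M.

(* Spinors are column vectors; [W] encodes a subspace by its rows. *)
Definition irreducible_module : Prop :=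
  (0 < N)%N /\
  forall W : 'M[R[i]]_N, (forall i, (W *m (Gam i)^T <= W)%MS) ->
    W = 0 \/ row_full W.

Definition cliff_vec (v : 'rV[R]_n) : 'M[R[i]]_N :=
  \sum_i (v 0 i)%:C *: Gam i.

Definition quad (v : 'rV[R]_n) : R := \sum_i eta i * v 0 i ^+ 2.

Definition cliff_prod (l : seq 'rV[R]_n) : 'M[R[i]]_N :=
  foldr (fun v G => cliff_vec v *m G) 1%:M l.

(* Spin(p,q), realised inside the automorphisms of the spinor module. *)
Definition spin_group (G : 'M[R[i]]_N) : Prop :=
  exists l : seq 'rV[R]_n, [/\ ~~ odd (size l),
    (forall v, v \in l -> quad v = 1 \/ quad v = -1) & G = cliff_prod l].

(* Its subgroup preserving space and time orientations. *)
Definition spin_plus (G : 'M[R[i]]_N) : Prop :=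
  exists l : seq 'rV[R]_n, [/\ ~~ odd (size l),
    (forall v, v \in l -> quad v = 1 \/ quad v = -1),
    \prod_(v <- l) quad v = 1 & G = cliff_prod l].

End CliffordModules.

(* A spin structure given by a lift to Spin(p,q) of the transition functions of
   the orthonormal frame bundle, relative to an open cover by domains of local
   orthonormal frames, together with the complex spinor module. *)
Record spin_structure (R : realType) (n : nat) (M : manifold R n)
    (g : metric M) := SpinStructure {
  sgn : 'I_n -> bool;
  rk : nat;
  Gam : 'I_n -> 'M[R[i]]_rk;
  Gam_clifford : clifford_relations sgn Gam;
  Gam_irreducible : irreducible_module Gam;
  sidx : Type;
  sdom : sidx -> set M;
  sdom_open : forall a, open (sdom a);
  sdom_cover : forall x, exists a, sdom a x;
  frame : sidx -> 'I_n -> M -> tvec M;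
  frame_vfield : forall a i, vfield (sdom a) (frame a i);
  frame_orthonormal : forall a i j x, sdom a x ->
    g x (frame a i x) (frame a j x) = eta R sgn i *+ (i == j);
  frame_span : forall a x v, sdom a x -> tangent x v ->
    exists c : 'I_n -> R, v = \sum_i c i *: frame a i x;
  trans : sidx -> sidx -> M -> 'M[R[i]]_rk;
  trans_smooth : forall a b x i j, sdom a x -> sdom b x ->
    csmooth_at x (fun y => trans a b y i j);
  trans_spin : forall a b x, sdom a x -> sdom b x ->
    spin_group sgn Gam (trans a b x);
  trans_cocycle : forall a b c x, sdom a x -> sdom b x -> sdom c x ->
    trans a b x *m trans b c x = trans a c x;
  (* the image of [trans a b x] in SO(p,q) is the change of frames *)
  trans_lift : forall a b x i, sdom a x -> sdom b x ->
    trans a b x *m Gam i =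
    (\sum_j (eta R sgn j * g x (frame b i x) (frame a j x))%:C *: Gam j)
      *m trans a b x
}.

Section SpinorBundle.
Variables (R : realType) (n : nat) (M : manifold R n) (g : metric M).
Variable s : spin_structure g.

(* An element of the spinor bundle over [x] is the family of its components in
   the spin frames around [x]; components in the other frames are set to 0. *)
Definition sfib : Type := sidx s -> 'cV[R[i]]_(rk s).

Definition spinor (x : M) (xi : sfib) : Prop :=
  (forall a b, sdom a x -> sdom b x -> xi a = trans a b x *m xi b) /\
  (forall a, ~ sdom a x -> xi a = 0).

Definition sfield (U : set M) (psi : M -> sfib) : Prop :=
  (forall x, U x -> spinor x (psi x)) /\
  (forall x a j, U x -> sdom a x -> csmooth_at x (fun y => psi y a j 0)).

(* The coefficient of e_i in [w] is eta_i g(w, e_i). *)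
Definition gamma (x : M) (w : tvec M) (xi : sfib) : sfib := fun a =>
  (\sum_i (eta R (@sgn _ _ _ _ s) i * g x w (frame a i x))%:C *: Gam s i)
    *m xi a.

Definition spin_act (a : sidx s) (x : M) (G : 'M[R[i]]_(rk s)) (xi : sfib) :
    sfib := fun b =>
  if `[< sdom b x >] then trans b a x *m (G *m xi a) else 0.

Variable nab : M -> tvec M -> (M -> tvec M) -> tvec M.

(* The connection induced on the spinor bundle; in a spin frame over the
   orthonormal frame (e_i) it is
   v + 1/4 sum_ij eta_i eta_j g(nabla_v e_i, e_j) gamma_i gamma_j. *)
Definition snabla (x : M) (v : tvec M) (psi : M -> sfib) : sfib := fun a =>
  if `[< sdom a x >] then
    (\col_j cderiv v (fun y => psi y a j 0)) +
    (4^-1 *: \sum_i \sum_j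
       (eta R (@sgn _ _ _ _ s) i * eta R (@sgn _ _ _ _ s) j *
        g x (nab x v (frame a i)) (frame a j x))%:C *: (Gam s i *m Gam s j))
      *m psi x a
  else 0.

Record spinor_connection (D : M -> tvec M -> (M -> sfib) -> sfib) : Prop :=
  SpinorConnection {
  sconn_spinor : forall U psi x v, open U -> U x -> sfield U psi ->
    tangent x v -> spinor x (D x v psi);
  sconn_linear : forall U psi x (a : R) v w, open U -> U x -> sfield U psi ->
    tangent x v -> tangent x w ->
    D x (a *: v + w) psi = a%:C *: D x v psi + D x w psi;
  sconn_add : forall U psi chi x v, open U -> U x -> sfield U psi ->
    sfield U chi -> tangent x v ->
    D x v (fun y => psi y + chi y) = D x v psi + D x v chi;
  sconn_leibniz : forall U (f : M -> R[i]) psi x v, open U -> U x ->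
    (forall y, U y -> csmooth_at y f) -> sfield U psi -> tangent x v ->
    D x v (fun y => f y *: psi y) = cderiv v f *: psi x + f x *: D x v psi;
  sconn_local : forall U psi chi x v, open U -> U x -> sfield U psi ->
    sfield U chi -> tangent x v -> (forall y, U y -> psi y = chi y) ->
    D x v psi = D x v chi;
  sconn_smooth : forall U X psi, open U -> vfield U X -> sfield U psi ->
    sfield U (fun y => D y (X y) psi)
}.

Record charge_conjugation (C : M -> sfib -> sfib -> R[i]) : Prop :=
  ChargeConjugation {
  cc_linearl : forall x (c : R[i]) xi zeta chi,
    spinor x xi -> spinor x zeta -> spinor x chi ->
    C x (c *: xi + zeta) chi = c * C x xi chi + C x zeta chi;
  cc_linearr : forall x (c : R[i]) xi zeta chi,
    spinor x xi -> spinor x zeta -> spinor x chi ->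
    C x chi (c *: xi + zeta) = c * C x chi xi + C x chi zeta;
  cc_smooth : forall U psi chi x, open U -> U x -> sfield U psi ->
    sfield U chi -> csmooth_at x (fun y => C y (psi y) (chi y));
  cc_nondeg : forall x xi, spinor x xi ->
    (forall chi, spinor x chi -> C x xi chi = 0) -> xi = 0;
  cc_spin_invariant : forall a x G xi chi, sdom a x ->
    spin_plus (@sgn _ _ _ _ s) (Gam s) G -> spinor x xi -> spinor x chi ->
    C x (spin_act a x G xi) (spin_act a x G chi) = C x xi chi;
  cc_parallel : forall U psi chi x v, open U -> U x -> sfield U psi ->
    sfield U chi -> tangent x v ->
    cderiv v (fun y => C y (psi y) (chi y)) =
    C x (snabla x v psi) (chi x) + C x (psi x) (snabla x v chi);
  cc_symm : (forall x xi chi, spinor x xi -> spinor x chi ->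
               C x xi chi = C x chi xi) \/
            (forall x xi chi, spinor x xi -> spinor x chi ->
               C x xi chi = - C x chi xi)
}.

Variable C : M -> sfib -> sfib -> R[i].

(* The vector u with g(u, w) = C(phi, gamma(w) psi) for all w *)
Definition C1 (phi psi : M -> sfib) (x : M) : ctvec M :=
  xget 0 [set u : ctvec M | ctangent x u /\ forall w, tangent x w ->
    cmetric g x u w = C x (phi x) (gamma x w (psi x))].

Definition spinor_bracket (phi psi : M -> sfib) (x : M) : ctvec M :=
  fun f => 2 * C1 phi psi x f.

(* Phi^C, for an endomorphism Phi of the fibre over [x] *)
Definition cadj (x : M) (Phi : sfib -> sfib) (xi : sfib) : sfib :=
  xget 0 [set zeta | spinor x zeta /\ forall chi, spinor x chi ->
    C x zeta chi = C x xi (Phi chi)].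

Definition sext (x : M) (xi : sfib) : M -> sfib :=
  xget (fun=> 0) [set sigma | sigma x = xi /\
    exists U, [/\ open U, U x & sfield U sigma]].

Variable D : M -> tvec M -> (M -> sfib) -> sfib.

(* The endomorphism-valued 1-form D - nabla.  The difference is tensorial, so
   the choice of the extension of [xi] is irrelevant. *)
Definition conn_form (x : M) (v : tvec M) (xi : sfib) : sfib :=
  D x v (sext x xi) - snabla x v (sext x xi).

(* D^C = nabla - (D - nabla)^C *)
Definition conn_dual (x : M) (v : tvec M) (psi : M -> sfib) : sfib :=
  snabla x v psi - cadj x (conn_form x v) (psi x).

(* ((D^_Z Phi)(X) xi)(x) *)
Definition conn_hat (Phi : M -> tvec M -> sfib -> sfib) (Z X : M -> tvec M)
    (xi : M -> sfib) (x : M) : sfib :=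
  D x (Z x) (fun y => Phi y (X y) (xi y)) - Phi x (nab x (Z x) X) (xi x)
  - Phi x (X x) (conn_dual x (Z x) xi).

Definition torsion (X Y : M -> tvec M) (xi : M -> sfib) (x : M) : sfib :=
  conn_hat gamma X Y xi x - conn_hat gamma Y X xi x.

End SpinorBundle.

(* Main.v *)
Require Import Defs.
From mathcomp Require Import all_boot all_order all_algebra.
From mathcomp Require Import complex ring spectral.
From mathcomp Require Import all_classical all_reals all_analysis.
Set Implicit Arguments.
Unset Strict Implicit.
Unset Printing Implicit Defensive.
Import Order.TTheory GRing.Theory Num.Theory.
Import numFieldNormedType.Exports.
Local Open Scope classical_set_scope.
Local Open Scope complex_scope.
Local Open Scope ring_scope.

(** With [K = C1 phi psi] and [D^C phi = D^C psi = 0], differentiating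
    [g(K, Y) = C(phi, gamma(Y) psi)] along [X] gives
    [g(nabla_X K, Y) = C(phi, (D^_X gamma)(Y) psi)]: the derivative of [phi] is
    the [C]-adjoint of [D - nabla], which turns [nabla_X (gamma(Y) psi)] into
    [D_X (gamma(Y) psi)].  The symmetric part of [nabla K] thus vanishes by
    hypothesis.  For this the fibrewise adjoint has to exist, which needs
    [D - nabla] to be a tensorial, spinor-valued form; the delicate point is
    that the coordinate expression of the spin connection is compatible with
    the transition functions. *)

(** * Smooth functions *)

Section Smoothness.
Variables (R : realType) (n : nat).
Implicit Types (O : set 'rV[R]_n) (f h : 'rV[R]_n -> R).

(** By Schur's lemma [trans_lift] fixes a transition matrix T only up to a scalar, so
    differentiating it yields the transformation law of the spin connection only up to a scalar. The
    trace excludes that scalar: the connection matrices are trace-free, and T is a product of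
    Clifford vectors with square 1 or -1, so [\det T ^+ 4 = 1] and the logarithmic derivative of the
    determinant vanishes. A second obstacle is that [sext], [cadj] and [C1] are choices with default
    0, meaningful only once their specifications are known to be satisfiable. The witnesses are
    local sections with constant components in a spin frame, a solution of a linear system with the
    Gram matrix of [C], and an expansion in an orthonormal frame. The factor 2 in the bracket
    matches the torsion: on [psi] the form [conn_hat] of [gamma] is antisymmetric, so its
    antisymmetrisation is twice itself. *)

Lemma Ck_continuous k O f x : Ck k O f -> O x -> {for x, continuous f}.
Proof. by case: k => [|k] [cf _]; exact: cf. Qed.

Lemma Ck_derivable k O f x (i : 'I_n) :
  Ck k.+1 O f -> O x -> derivable f x (delta_mx 0 i).
Proof. by move=> [_ /(_ i)[df _]]; exact: df. Qed.

Lemma Ck_derive k O f (i : 'I_n) :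
  Ck k.+1 O f -> Ck k O (fun x => 'D_(delta_mx 0 i) f x).
Proof. by move=> [_ /(_ i)[]]. Qed.

Arguments Ck_derivable {k O f x} i.
Arguments Ck_derive {k O f} i.

(** The derivatives must drop one order as well, hence the induction. *)
Lemma Ck_pred k O f : Ck k.+1 O f -> Ck k O f.
Proof.
elim: k f => [|k IH] f fC; split=> //; try by move=> x; exact: Ck_continuous fC.
move=> i; split; first by move=> x; exact: Ck_derivable fC.
exact/IH/Ck_derive.
Qed.

Lemma Ck_sub k O O' f : O' `<=` O -> Ck k O f -> Ck k O' f.
Proof.
move=> sO; elim: k f => [|k IH] f fC; split=> //.
- by move=> x /sO; exact: Ck_continuous fC.
- by move=> x /sO; exact: Ck_continuous fC.
- move=> i; split; last exact/IH/Ck_derive.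
  by move=> x /sO; exact: Ck_derivable fC.
Qed.

(** Continuity, derivability and derivatives depend on germs only, and equality on the open set [O]
    is equality of germs at each of its points. *)
Lemma Ck_eq k O f h : open O -> (forall x, O x -> f x = h x) ->
  Ck k O f -> Ck k O h.
Proof.
move=> Oo; elim: k f h => [|k IH] f h fh fC.
all: have nfh x : O x -> \forall y \near x, f y = h y
  by move=> Ox; apply: filterS (open_nbhs_nbhs (conj Oo Ox)).
all: have hc x : O x -> {for x, continuous h}
  by move=> Ox; rewrite /prop_for /continuous_at -(fh x Ox);
     apply: cvg_trans (Ck_continuous fC Ox); exact: (near_eq_cvg (F := nbhs x) (nfh _ Ox)).
- by split.
- split=> // i; split.
    by move=> x Ox; exact: (near_eq_derivable (nfh _ Ox) (Ck_derivable i fC Ox)).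
  apply: IH (Ck_derive i fC) => x Ox.
  exact: (near_eq_derive _ (nfh _ Ox)).
Qed.

Lemma Ck_cst k O (c : R) : open O -> Ck k O (fun=> c).
Proof.
move=> Oo; elim: k c => [|k IH] c; split=> //.
- by move=> x _; exact: cst_continuous.
- by move=> x _; exact: cst_continuous.
- move=> i; split; first by move=> x _; exact: derivable_cst.
  by apply: Ck_eq (IH 0) => // x Ox; rewrite derive_cst.
Qed.

Lemma Ck_add k O f h : open O -> Ck k O f -> Ck k O h ->
  Ck k O (fun x => f x + h x).
Proof.
move=> Oo; elim: k f h => [|k IH] f h fC hC; split=> //.
- by move=> x Ox; exact: (cvgD (Ck_continuous fC Ox) (Ck_continuous hC Ox)).
- by move=> x Ox; exact: (cvgD (Ck_continuous fC Ox) (Ck_continuous hC Ox)).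
- move=> i; split.
    by move=> x Ox; exact: (derivableD (Ck_derivable i fC Ox) (Ck_derivable i hC Ox)).
  apply: Ck_eq (IH _ _ (Ck_derive i fC) (Ck_derive i hC)) => // x Ox.
  by rewrite (deriveD (Ck_derivable i fC Ox) (Ck_derivable i hC Ox)).
Qed.

(** In the Leibniz rule each product has one undifferentiated factor, whose order [Ck_pred] lowers
    to match. *)
Lemma Ck_mul k O f h : open O -> Ck k O f -> Ck k O h ->
  Ck k O (fun x => f x * h x).
Proof.
move=> Oo; elim: k f h => [|k IH] f h fC hC; split=> //.
- by move=> x Ox; exact: (cvgM (Ck_continuous fC Ox) (Ck_continuous hC Ox)).
- by move=> x Ox; exact: (cvgM (Ck_continuous fC Ox) (Ck_continuous hC Ox)).
- move=> i; split.
    by move=> x Ox; exact: (derivableM (Ck_derivable i fC Ox) (Ck_derivable i hC Ox)).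
  have := Ck_add Oo (IH _ _ (Ck_pred fC) (Ck_derive i hC))
    (IH _ _ (Ck_pred hC) (Ck_derive i fC)).
  apply: Ck_eq => // x Ox.
  by rewrite (deriveM (Ck_derivable i fC Ox) (Ck_derivable i hC Ox)).
Qed.

End Smoothness.

(** * Real and complex smooth germs on the manifold *)

Section SmoothGerms.
Variables (R : realType) (n : nat) (M : manifold R n).
Implicit Types (f h : M -> R) (x : M).

(** Inside the open chart image, membership means that [chart_inv c] lands in [W], which by
    continuity persists nearby. *)
Lemma chart_image_open (W : set M) (c : chart M) : open W ->
  open (chart_map c @` (W `&` chart_dom c)).
Proof.
move=> Wo; rewrite openE => _ [x [Wx cx] <-].
have nI : \forall z \near chart_map c x, (chart_map c @` chart_dom c) z.
  by apply: open_nbhs_nbhs; split; [exact: chart_img_open|exists x].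
have nW : \forall z \near chart_map c x, W (chart_inv c z).
  apply: (chart_inv_cont cx); rewrite chart_mapK //.
  exact: open_nbhs_nbhs.
apply: filterS2 nI nW => z [y cy <-]; rewrite chart_mapK // => Wy.
by exists y.
Qed.

Lemma smooth_at_eq (U : set M) x f h : open U -> U x ->
  (forall y, U y -> f y = h y) -> smooth_at x f -> smooth_at x h.
Proof.
move=> Uo Ux fh [W [Wo Wx fW]]; exists (W `&` U); split=> //; first exact: openI.
move=> c k; have WU : open (chart_map c @` ((W `&` U) `&` chart_dom c)).
  exact/chart_image_open/openI.
apply: Ck_eq (Ck_sub _ (fW c k)) => //.
  by move=> _ [y [[_ Uy] cy] <-] /=; rewrite chart_mapK // fh.
by apply: image_subset => y [[]].
Qed.

Lemma smooth_at_cst x (c : R) : smooth_at x (fun=> c).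
Proof.
exists setT; split=> //; first exact: openT.
by move=> d k; apply: Ck_cst; apply: chart_image_open; exact: openT.
Qed.

Lemma smooth_at_op (op : R -> R -> R) x f h :
  (forall k (O : set 'rV[R]_n) u w, open O -> Ck k O u -> Ck k O w ->
     Ck k O (fun z => op (u z) (w z))) ->
  smooth_at x f -> smooth_at x h -> smooth_at x (fun y => op (f y) (h y)).
Proof.
move=> Ckop [W [Wo Wx fW]] [V [Vo Vx hV]]; exists (W `&` V).
split=> //; first exact: openI.
move=> c k; apply: (Ckop k _ (f \o chart_inv c) (h \o chart_inv c)).
- exact/chart_image_open/openI.
- by apply: Ck_sub (fW c k); apply: image_subset => y [[]].
- by apply: Ck_sub (hV c k); apply: image_subset => y [[]].
Qed.

Lemma smooth_at_add x f h : smooth_at x f -> smooth_at x h ->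
  smooth_at x (fun y => f y + h y).
Proof. by apply: smooth_at_op => *; exact: Ck_add. Qed.

Lemma smooth_at_mul x f h : smooth_at x f -> smooth_at x h ->
  smooth_at x (fun y => f y * h y).
Proof. by apply: smooth_at_op => *; exact: Ck_mul. Qed.

Lemma smooth_at_opp x f : smooth_at x f -> smooth_at x (fun y => - f y).
Proof.
move=> fs; have := smooth_at_mul (smooth_at_cst x (-1)) fs.
by apply: (smooth_at_eq openT) => // y _; rewrite mulN1r.
Qed.

Lemma smooth_at_sum (I : Type) (r : seq I) (P : pred I) (F : I -> M -> R) x :
  (forall i, P i -> smooth_at x (F i)) ->
  smooth_at x (fun y => \sum_(i <- r | P i) F i y).
Proof.
move=> Fs; elim: r => [|i r IH].
  apply: (smooth_at_eq openT) (smooth_at_cst x 0) => // y _.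
  by rewrite big_nil.
case Pi: (P i); last first.
  by apply: (smooth_at_eq openT) IH => // y _; rewrite big_cons Pi.
apply: (smooth_at_eq openT) (smooth_at_add (Fs i Pi) IH) => // y _.
by rewrite big_cons Pi.
Qed.

Implicit Types (F H : M -> R[i]).

Lemma csmooth_at_eq (U : set M) x F H : open U -> U x ->
  (forall y, U y -> F y = H y) -> csmooth_at x F -> csmooth_at x H.
Proof.
by move=> Uo Ux FH [reF imF]; split;
  [apply: (smooth_at_eq Uo Ux) reF|apply: (smooth_at_eq Uo Ux) imF] => // y Uy; rewrite FH.
Qed.

Lemma csmooth_at_cst x (c : R[i]) : csmooth_at x (fun=> c).
Proof. by split; exact: smooth_at_cst. Qed.

Lemma csmooth_at_add x F H : csmooth_at x F -> csmooth_at x H ->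
  csmooth_at x (fun y => F y + H y).
Proof.
move=> [? ?] [? ?]; split.
  have : smooth_at x (fun y => complex.Re (F y) + complex.Re (H y)) by exact: smooth_at_add.
  by apply: (smooth_at_eq openT) => // y _; case: (F y) (H y) => ? ? [? ?].
have : smooth_at x (fun y => complex.Im (F y) + complex.Im (H y)) by exact: smooth_at_add.
by apply: (smooth_at_eq openT) => // y _; case: (F y) (H y) => ? ? [? ?].
Qed.

Lemma csmooth_at_mul x F H : csmooth_at x F -> csmooth_at x H ->
  csmooth_at x (fun y => F y * H y).
Proof.
move=> [? ?] [? ?]; split.
  have : smooth_at x (fun y => complex.Re (F y) * complex.Re (H y)
      + - (complex.Im (F y) * complex.Im (H y))).
    by apply: smooth_at_add; [|apply: smooth_at_opp]; exact: smooth_at_mul.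
  by apply: (smooth_at_eq openT) => // y _; case: (F y) (H y) => ? ? [? ?].
have : smooth_at x (fun y => complex.Re (F y) * complex.Im (H y)
    + complex.Im (F y) * complex.Re (H y)).
  by apply: smooth_at_add; exact: smooth_at_mul.
by apply: (smooth_at_eq openT) => // y _; case: (F y) (H y) => ? ? [? ?].
Qed.

Lemma csmooth_at_real x f : smooth_at x f -> csmooth_at x (fun y => (f y)%:C).
Proof. by move=> fs; split=> //=; exact: smooth_at_cst. Qed.

Lemma csmooth_at_sum (I : Type) (r : seq I) (P : pred I) (F : I -> M -> R[i]) x :
  (forall i, P i -> csmooth_at x (F i)) ->
  csmooth_at x (fun y => \sum_(i <- r | P i) F i y).
Proof.
move=> Fs; elim: r => [|i r IH].
  apply: (csmooth_at_eq openT) (csmooth_at_cst x 0) => // y _.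
  by rewrite big_nil.
case Pi: (P i); last first.
  by apply: (csmooth_at_eq openT) IH => // y _; rewrite big_cons Pi.
apply: (csmooth_at_eq openT) (csmooth_at_add (Fs i Pi) IH) => // y _.
by rewrite big_cons Pi.
Qed.

Lemma csmooth_at_prod (I : Type) (r : seq I) (P : pred I) (F : I -> M -> R[i]) x :
  (forall i, P i -> csmooth_at x (F i)) ->
  csmooth_at x (fun y => \prod_(i <- r | P i) F i y).
Proof.
move=> Fs; elim: r => [|i r IH].
  apply: (csmooth_at_eq openT) (csmooth_at_cst x 1) => // y _.
  by rewrite big_nil.
case Pi: (P i); last first.
  by apply: (csmooth_at_eq openT) IH => // y _; rewrite big_cons Pi.
apply: (csmooth_at_eq openT) (csmooth_at_mul (Fs i Pi) IH) => // y _.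
by rewrite big_cons Pi.
Qed.

End SmoothGerms.

(** * Tangent vectors as derivations *)

Lemma complex_ext (R : realType) (a b : R[i]) :
  complex.Re a = complex.Re b -> complex.Im a = complex.Im b -> a = b.
Proof. by case: a b => ? ? [? ?] /= -> ->. Qed.

Lemma ReD (R : realType) (a b : R[i]) :
  complex.Re (a + b) = complex.Re a + complex.Re b.
Proof. by case: a b => ? ? []. Qed.

Lemma ImD (R : realType) (a b : R[i]) :
  complex.Im (a + b) = complex.Im a + complex.Im b.
Proof. by case: a b => ? ? []. Qed.

Lemma ReM (R : realType) (a b : R[i]) : complex.Re (a * b) =
  complex.Re a * complex.Re b - complex.Im a * complex.Im b.
Proof. by case: a b => ? ? []. Qed.

Lemma ImM (R : realType) (a b : R[i]) : complex.Im (a * b) =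
  complex.Re a * complex.Im b + complex.Im a * complex.Re b.
Proof. by case: a b => ? ? []. Qed.

Definition ReImE := (ReD, ImD, ReM, ImM).

Section Derivations.
Variables (R : realType) (n : nat) (M : manifold R n).
Implicit Types (f h : M -> R) (x : M) (u v w : tvec M) (F H : M -> R[i]).

Lemma tvec_ext v f h : f =1 h -> v f = v h.
Proof. by move=> /funext ->. Qed.

Lemma tangent_eq (U : set M) x v f h : tangent x v -> open U -> U x ->
  smooth_at x f -> (forall y, U y -> f y = h y) -> v f = v h.
Proof.
move=> vT Uo Ux fs fh; apply: (tangent_local vT) => //.
  exact: (smooth_at_eq Uo Ux fh).
by apply: filterS (open_nbhs_nbhs (conj Uo Ux)).
Qed.

Lemma tangent_add x v f h : tangent x v -> smooth_at x f -> smooth_at x h ->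
  v (fun y => f y + h y) = v f + v h.
Proof.
move=> vT fs hs; rewrite -[v f]mul1r -(tangent_linear vT 1) //.
by apply tvec_ext => y; rewrite mul1r.
Qed.

(** Leibniz on [1 * 1] gives [v 1 = v 1 + v 1]; linearity does the rest. *)
Lemma tangent_cst x v (c : R) : tangent x v -> v (fun=> c) = 0.
Proof.
move=> vT; have s1 := smooth_at_cst x 1; have s0 := smooth_at_cst x 0.
have v0 : v (fun=> 0) = 0.
  apply: (addrI (v (fun=> 0))); rewrite -(tangent_add vT) //.
  by rewrite !addr0.
have v1 : v (fun=> 1) = 0.
  apply: (addrI (v (fun=> 1))); rewrite addr0.
  by have := tangent_leibniz vT s1 s1; rewrite !mulr1 mul1r => <-.
by have := tangent_linear vT c s1 s0; rewrite v0 v1 !mulr0 !addr0 !mulr1.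
Qed.

Lemma tangent_scale x v (c : R) f : tangent x v -> smooth_at x f ->
  v (fun y => c * f y) = c * v f.
Proof.
move=> vT fs; rewrite (tangent_leibniz vT) //; last exact: smooth_at_cst.
by rewrite (tangent_cst c vT) mul0r add0r.
Qed.

Lemma tvec_combE (a : R) v w f : (a *: v + w : tvec M) f = a * (v f : R) + w f.
Proof. by []. Qed.

Lemma tangent_comb x (a : R) v w : tangent x v -> tangent x w ->
  tangent x (a *: v + w).
Proof.
move=> vT wT; split => [b f h fs hs|f h fs hs|f h fs hs fh|f nf].
all: rewrite !tvec_combE.
- by rewrite (tangent_linear vT) // (tangent_linear wT) //; ring.
- by rewrite (tangent_leibniz vT) // (tangent_leibniz wT) //; ring.
- by rewrite (tangent_local vT fs hs) // (tangent_local wT fs hs).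
- by rewrite (tangent_norm vT nf) (tangent_norm wT nf); ring.
Qed.

Lemma tangent0 x : tangent x (0 : tvec M).
Proof.
split => [b f h fs hs|f h fs hs|f h fs hs fh|f nf] //.
- by rewrite mulr0 addr0.
- by rewrite mul0r mulr0 addr0.
Qed.

Lemma tangentZ x (a : R) v : tangent x v -> tangent x (a *: v).
Proof. by move=> vT; rewrite -[_ *: _]addr0; exact: tangent_comb (tangent0 x). Qed.

Lemma tangentD x v w : tangent x v -> tangent x w -> tangent x (v + w).
Proof. by move=> vT wT; rewrite -[v]scale1r; exact: tangent_comb. Qed.

Lemma tangent_sum x (I : Type) (r : seq I) (P : pred I) (V : I -> tvec M) :
  (forall i, P i -> tangent x (V i)) -> tangent x (\sum_(i <- r | P i) V i).
Proof.
move=> VT; elim/big_rec: _ => [|i v Pi vT]; first exact: tangent0.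
by apply: tangentD => //; exact: VT.
Qed.

Lemma cderiv_cst x v (c : R[i]) : tangent x v -> cderiv v (fun=> c) = 0.
Proof. by move=> vT; rewrite /cderiv !(tangent_cst _ vT). Qed.

Lemma cderiv_eq (U : set M) x v F H : tangent x v -> open U -> U x ->
  csmooth_at x F -> (forall y, U y -> F y = H y) -> cderiv v F = cderiv v H.
Proof.
move=> vT Uo Ux [reF imF] FH; apply: complex_ext => /=.
  by apply: (tangent_eq vT Uo Ux) => // y Uy; rewrite FH.
by apply: (tangent_eq vT Uo Ux) => // y Uy; rewrite FH.
Qed.

Lemma cderiv_add x v F H : tangent x v -> csmooth_at x F -> csmooth_at x H ->
  cderiv v (fun y => F y + H y) = cderiv v F + cderiv v H.
Proof.
move=> vT [reF imF] [reH imH]; apply: complex_ext; rewrite ReImE /=.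
  by rewrite -(tangent_add vT) //; apply tvec_ext => y; rewrite ReImE.
by rewrite -(tangent_add vT) //; apply tvec_ext => y; rewrite ReImE.
Qed.

Lemma cderiv_mul x v F H : tangent x v -> csmooth_at x F -> csmooth_at x H ->
  cderiv v (fun y => F y * H y) = cderiv v F * H x + F x * cderiv v H.
Proof.
move=> vT [reF imF] [reH imH]; apply: complex_ext; rewrite !ReImE /=.
  transitivity (v (fun y => complex.Re (F y) * complex.Re (H y)
      + (-1) * (complex.Im (F y) * complex.Im (H y)))).
    by apply tvec_ext => y; rewrite ReImE mulN1r.
  have s1 := smooth_at_mul imF imH.
  rewrite (tangent_add vT) ?(tangent_scale _ vT) ?(tangent_leibniz vT) //.
  - by ring.
  - exact: smooth_at_mul.
  - by apply: smooth_at_mul => //; exact: smooth_at_cst.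
transitivity (v (fun y => complex.Re (F y) * complex.Im (H y)
    + complex.Im (F y) * complex.Re (H y))).
  by apply tvec_ext => y; rewrite ReImE.
rewrite (tangent_add vT) ?(tangent_leibniz vT) //; try exact: smooth_at_mul.
by ring.
Qed.

Lemma cderiv_scale x v (c : R[i]) F : tangent x v -> csmooth_at x F ->
  cderiv v (fun y => c * F y) = c * cderiv v F.
Proof.
move=> vT Fs; rewrite (cderiv_mul vT (csmooth_at_cst x c) Fs).
by rewrite (cderiv_cst c vT) mul0r add0r.
Qed.

Lemma cderiv_real x v f : tangent x v -> cderiv v (fun y => (f y)%:C) = (v f : R)%:C.
Proof. by move=> vT; apply: complex_ext => //=; exact: tangent_cst vT. Qed.

Lemma cderiv_sum x v (I : Type) (r : seq I) (P : pred I) (F : I -> M -> R[i]) :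
  tangent x v -> (forall i, P i -> csmooth_at x (F i)) ->
  cderiv v (fun y => \sum_(i <- r | P i) F i y) =
  \sum_(i <- r | P i) cderiv v (F i).
Proof.
move=> vT Fs; elim: r => [|i r IH].
  rewrite big_nil; transitivity (cderiv v (fun=> 0)); last exact: cderiv_cst vT.
  by congr (cderiv v _); apply/funext => y; rewrite big_nil.
rewrite big_cons; case: ifPn => Pi.
  rewrite -IH -(cderiv_add vT (Fs i Pi)); last exact: csmooth_at_sum.
  by congr (cderiv v _); apply/funext => y; rewrite big_cons Pi.
rewrite -IH; congr (cderiv v _).
by apply/funext => y; rewrite big_cons (negbTE Pi).
Qed.

(** Since [r] is duplicate-free, the filter [j != i] removes exactly the differentiated factor. *)
Lemma cderiv_prod x v (I : eqType) (r : seq I) (F : I -> M -> R[i]) :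
  tangent x v -> (forall i, csmooth_at x (F i)) -> uniq r ->
  cderiv v (fun y => \prod_(i <- r) F i y) =
  \sum_(i <- r) cderiv v (F i) * \prod_(j <- r | j != i) F j x.
Proof.
move=> vT Fs; elim: r => [_|i r IH /= /andP[nir ur]].
  rewrite big_nil; transitivity (cderiv v (fun=> 1)); last exact: cderiv_cst vT.
  by congr (cderiv v _); apply/funext => y; rewrite big_nil.
transitivity (cderiv v (fun y => F i y * \prod_(j <- r) F j y)).
  by congr (cderiv v _); apply/funext => y; rewrite big_cons.
rewrite (cderiv_mul vT) //; last exact: csmooth_at_prod.
rewrite IH // !big_cons eqxx /= mulr_sumr; congr (_ + _).
  congr (_ * _); rewrite big_seq [RHS]big_seq_cond; apply: eq_bigl => j.
  by case jr: (j \in r) => //=; apply/esym/eqP => ji; rewrite -ji jr in nir.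
apply: eq_big_seq => j jr.
rewrite big_cons ifT; first by ring.
by apply/eqP => ij; rewrite ij jr in nir.
Qed.

End Derivations.
Arguments cderiv_sum {R n M x v I r P F}.

(** * Derivatives of matrix-valued functions and of determinants *)

Section MatrixDerivations.
Variables (R : realType) (n : nat) (M : manifold R n).

Definition msmooth_at (x : M) (m p : nat) (F : M -> 'M[R[i]]_(m, p)) : Prop :=
  forall i j, csmooth_at x (fun y => F y i j).

Definition dmx (v : tvec M) (m p : nat) (F : M -> 'M[R[i]]_(m, p)) :
    'M[R[i]]_(m, p) :=
  \matrix_(i, j) cderiv v (fun y => F y i j).

Lemma msmooth_at_mul x m p q (F : M -> 'M[R[i]]_(m, p))
    (H : M -> 'M[R[i]]_(p, q)) :
  msmooth_at x F -> msmooth_at x H -> msmooth_at x (fun y => F y *m H y).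
Proof.
move=> Fs Hs i j.
have : csmooth_at x (fun y => \sum_k F y i k * H y k j).
  by apply: csmooth_at_sum => k _; exact: csmooth_at_mul.
by apply: (csmooth_at_eq openT) => // y _; rewrite mxE.
Qed.

Lemma msmooth_at_cst x m p (A : 'M[R[i]]_(m, p)) : msmooth_at x (fun=> A).
Proof. by move=> i j; exact: csmooth_at_cst. Qed.

Lemma msmooth_at_lincomb x m p (I : finType) (c : I -> M -> R[i])
    (A : I -> 'M[R[i]]_(m, p)) : (forall i, csmooth_at x (c i)) ->
  msmooth_at x (fun y => \sum_i c i y *: A i).
Proof.
move=> cs k l; have : csmooth_at x (fun y => \sum_i c i y * A i k l).
  apply: csmooth_at_sum => i _.
  by apply: csmooth_at_mul => //; exact: csmooth_at_cst.
apply: (csmooth_at_eq openT) => // y _; rewrite summxE.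
by apply: eq_bigr => i _; rewrite mxE.
Qed.

Lemma dmx_eq (U : set M) x v m p (F H : M -> 'M[R[i]]_(m, p)) : tangent x v ->
  open U -> U x -> msmooth_at x F -> (forall y, U y -> F y = H y) ->
  dmx v F = dmx v H.
Proof.
move=> vT Uo Ux Fs FH; apply/matrixP => i j; rewrite !mxE.
by apply: (cderiv_eq vT Uo Ux) => // y Uy; rewrite FH.
Qed.

Lemma dmx_mul x v m p q (F : M -> 'M[R[i]]_(m, p)) (H : M -> 'M[R[i]]_(p, q)) :
  tangent x v -> msmooth_at x F -> msmooth_at x H ->
  dmx v (fun y => F y *m H y) = dmx v F *m H x + F x *m dmx v H.
Proof.
move=> vT Fs Hs; apply/matrixP => i j; rewrite !mxE -big_split /=.
transitivity (cderiv v (fun y => \sum_k F y i k * H y k j)).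
  by congr (cderiv v _); apply/funext => y; rewrite mxE.
rewrite (cderiv_sum vT); last by move=> k _; exact: csmooth_at_mul.
by apply: eq_bigr => k _; rewrite (cderiv_mul vT) // !mxE.
Qed.

Lemma dmx_lincomb x v m p (I : finType) (c : I -> M -> R[i])
    (A : I -> 'M[R[i]]_(m, p)) :
  tangent x v -> (forall i, csmooth_at x (c i)) ->
  dmx v (fun y => \sum_i c i y *: A i) = \sum_i cderiv v (c i) *: A i.
Proof.
move=> vT cs; apply/matrixP => k l; rewrite !mxE summxE.
transitivity (cderiv v (fun y => \sum_i A i k l * c i y)).
  congr (cderiv v _); apply/funext => y; rewrite summxE.
  by apply: eq_bigr => i _; rewrite mxE mulrC.
rewrite (cderiv_sum vT); last first.
  by move=> i _; apply: csmooth_at_mul => //; exact: csmooth_at_cst.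
by apply: eq_bigr => i _; rewrite (cderiv_scale _ vT) // !mxE mulrC.
Qed.

Lemma csmooth_at_det x m (F : M -> 'M[R[i]]_m) : msmooth_at x F ->
  csmooth_at x (fun y => \det (F y)).
Proof.
move=> Fs; rewrite /determinant; apply: csmooth_at_sum => s _.
apply: csmooth_at_mul; first exact: csmooth_at_cst.
by apply: csmooth_at_prod => i _; exact: Fs.
Qed.

(* Jacobi's formula: each term of the Leibniz rule is the determinant of F with
   one row replaced by its derivative, expanded along that row. *)
Lemma cderiv_det x v m (F : M -> 'M[R[i]]_m) : tangent x v -> msmooth_at x F ->
  cderiv v (fun y => \det (F y)) = \tr (dmx v F *m \adj (F x)).
Proof.
move=> vT Fs; rewrite /determinant.
rewrite (cderiv_sum vT); last first.
  move=> s _; apply: csmooth_at_mul; first exact: csmooth_at_cst.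
  by apply: csmooth_at_prod => i _; exact: Fs.
pose G i := \matrix_(k, l) if k == i then dmx v F k l else F x k l.
transitivity (\sum_i \det (G i)).
  rewrite /determinant exchange_big /=; apply: eq_bigr => s _.
  rewrite (cderiv_scale _ vT); last first.
    by apply: csmooth_at_prod => i _; exact: Fs.
  rewrite (cderiv_prod vT) //; last exact: index_enum_uniq.
  rewrite mulr_sumr; apply: eq_bigr => i _; congr (_ * _).
  rewrite [RHS](bigD1 i) //= {1}/G !mxE eqxx; congr (_ * _).
  by apply: eq_bigr => j ji; rewrite mxE (negbTE ji).
rewrite /mxtrace; apply: eq_bigr => i _; rewrite (expand_det_row _ i) mxE.
apply: eq_bigr => k _; rewrite !mxE eqxx ?mxE; congr (_ * _).
rewrite /cofactor; congr (_ * \det _).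
by apply/matrixP => a b; rewrite !mxE eq_sym (negbTE (neq_lift _ _)).
Qed.

End MatrixDerivations.

(** * Clifford modules *)

Section CliffordAlgebra.
Variables (R : realType) (n N : nat) (sg : 'I_n -> bool).
Variable Gam : 'I_n -> 'M[R[i]]_N.
Hypothesis GamC : clifford_relations sg Gam.

Lemma eta_sqr i : eta R sg i * eta R sg i = 1.
Proof. by rewrite -expr2 sqrr_sign. Qed.

Lemma Gam_anticomm i j : Gam i *m Gam j =
  (- 2 * eta R sg i *+ (i == j))%:C%:M - Gam j *m Gam i.
Proof. by rewrite -GamC addrK. Qed.

(** Two anticommutations carry [Gam k] through the product and leave only vectors: bivectors act on
    vectors as infinitesimal rotations. *)
Lemma Gam_comm2 i j k : Gam i *m Gam j *m Gam k - Gam k *m (Gam i *m Gam j) =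
  (- 2 * eta R sg j *+ (j == k))%:C *: Gam i
  - (- 2 * eta R sg i *+ (i == k))%:C *: Gam j.
Proof.
rewrite -mulmxA (Gam_anticomm j k) mulmxBr [Gam i *m (Gam k *m _)]mulmxA (Gam_anticomm i k) mulmxBl.
rewrite mul_scalar_mx mul_mx_scalar mulmxA.
by rewrite opprB addrA addrAC addrK.
Qed.

(** By [Gam_comm2] and antisymmetry of [om], the two factors of the bivector contribute
    [2 * eta_j * om k j] each; the total 4 is cancelled by [4^-1]. Thus [Om] is the spin lift of the
    infinitesimal rotation [om]. *)
Lemma spin_connection_comm (om : 'I_n -> 'I_n -> R) k
    (Om := 4^-1 *: \sum_i \sum_j
     (eta R sg i * eta R sg j * om i j)%:C *: (Gam i *m Gam j)) :
  (forall i j, om i j = - om j i) ->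
  Om *m Gam k - Gam k *m Om = \sum_j (eta R sg j * om k j)%:C *: Gam j.
Proof.
move=> omA; rewrite -scalemxAl -scalemxAr -scalerBr.
apply: (scalerI (a := 4)); first by rewrite pnatr_eq0.
rewrite scalerA divff ?pnatr_eq0 // scale1r mulmx_suml mulmx_sumr -sumrB.
under eq_bigr => i _ do (rewrite mulmx_suml mulmx_sumr -sumrB;
  under eq_bigr => j _ do rewrite -scalemxAl -scalemxAr -scalerBr Gam_comm2 scalerBr !scalerA).
under eq_bigr => i _ do rewrite sumrB.
rewrite sumrB.
transitivity (\sum_j (2 * (eta R sg j * om k j))%:C *: Gam j
    - \sum_j (- 2 * (eta R sg j * om k j))%:C *: Gam j).
  congr (_ - _).
    apply: eq_bigr => i _; rewrite (bigD1 k) //= eqxx big1 ?addr0.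
      congr (_ *: _); rewrite -rmorphM /= mulr1n; congr (_%:C).
      by rewrite (omA i k); transitivity
        (2 * (eta R sg i * om k i) * (eta R sg k * eta R sg k));
        [ring|rewrite eta_sqr mulr1].
    by move=> j /negbTE ->; rewrite mulr0n mulr0 scale0r.
  rewrite exchange_big; apply: eq_bigr => j _ /=.
  rewrite (bigD1 k) //= eqxx big1 ?addr0.
    congr (_ *: _); rewrite -rmorphM /= mulr1n; congr (_%:C).
    by transitivity (- 2 * (eta R sg j * om k j) * (eta R sg k * eta R sg k));
      [ring|rewrite eta_sqr mulr1].
  by move=> i /negbTE ->; rewrite mulr0n mulr0 scale0r.
rewrite -sumrB scaler_sumr; apply: eq_bigr => j _.
rewrite -scalerBl scalerA; congr (_ *: _).
by rewrite mulNr raddfN rmorphM rmorph_nat /=; ring.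
Qed.

(** Diagonal terms have [om i i = 0]; off the diagonal the gammas anticommute, so cyclicity makes
    the trace of their product its own opposite. *)
Lemma spin_connection_tr (om : 'I_n -> 'I_n -> R) :
  (forall i j, om i j = - om j i) ->
  \tr (4^-1 *: \sum_i \sum_j
     (eta R sg i * eta R sg j * om i j)%:C *: (Gam i *m Gam j)) = 0.
Proof.
move=> omA; rewrite mxtraceZ raddf_sum big1 ?mulr0 // => i _.
rewrite raddf_sum big1 // => j _; rewrite /= mxtraceZ.
have [<-|/negbTE ij] := eqVneq i j.
  have -> : om i i = 0; last by rewrite mulr0 mul0r.
  by apply/eqP; rewrite -eqNr -omA.
suff -> : \tr (Gam i *m Gam j) = 0 by rewrite mulr0.
apply/eqP; rewrite -eqNr; apply/eqP; rewrite [in RHS]Gam_anticomm ij.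
by rewrite mulr0n !raddf0 sub0r raddfN /= mxtrace_mulC.
Qed.

(** Schur's lemma: over the algebraically closed [R[i]] there is a nonzero eigenspace, and it is
    stable under the module, hence everything. The transposes arise because subspaces are encoded by
    rows while spinors are columns. *)
Lemma clifford_commutant (F : 'M[R[i]]_N) : irreducible_module Gam ->
  (forall i, F *m Gam i = Gam i *m F) -> exists a, F = a%:M.
Proof.
move=> [N0 irr] FG; have [a aF] := eigenvalue_closed F^T N0; exists a.
have eW : eigenspace F^T a *m F^T = a *: eigenspace F^T a.
  exact/eigenspaceP/submx_refl.
case: (irr (eigenspace F^T a)) => [i|E0|/row_fullP[B BE]].
- apply/eigenspaceP; rewrite -mulmxA -trmx_mul FG trmx_mul mulmxA.
  by rewrite eW; apply/esym; apply: scalemxAl.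
- by move: aF; rewrite /eigenvalue E0 eqxx.
- apply: trmx_inj; rewrite tr_scalar_mx -[F^T]mul1mx -BE -mulmxA.
  by rewrite eW -scalemxAr BE scalemx1.
Qed.

(** Adding the double sum to its copy with the gammas swapped lets the anticommutation relations
    apply; only the diagonal survives. *)
Lemma cliff_vec_sqr v : cliff_vec Gam v *m cliff_vec Gam v = (- (quad sg v)%:C)%:M.
Proof.
pose S := \sum_i \sum_j ((v 0 i)%:C * (v 0 j)%:C) *: (Gam i *m Gam j).
have -> : cliff_vec Gam v *m cliff_vec Gam v = S.
  rewrite /cliff_vec mulmx_suml; apply: eq_bigr => i _.
  rewrite mulmx_sumr; apply: eq_bigr => j _.
  by rewrite -scalemxAl -scalemxAr scalerA.
have SE : S = \sum_i \sum_j ((v 0 i)%:C * (v 0 j)%:C) *: (Gam j *m Gam i).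
  rewrite /S exchange_big; apply: eq_bigr => j _; apply: eq_bigr => i _.
  by rewrite mulrC.
apply: (scalerI (a := 2)); first by rewrite pnatr_eq0.
rewrite [LHS]scaler_nat mulr2n {2}SE /S -big_split /=.
rewrite scale_scalar_mx /quad raddf_sum mulrN mulr_sumr -sumrN raddf_sum.
apply: eq_bigr => i _ /=; rewrite -big_split /=.
under eq_bigr => j _ do rewrite -scalerDr GamC.
rewrite (bigD1 i) //= eqxx big1 ?addr0; last first.
  by move=> j; rewrite eq_sym => /negbTE ->; rewrite mulr0n raddf0 scaler0.
rewrite scale_scalar_mx; congr (_%:M).
rewrite mulr1n -[2 in RHS](rmorph_nat (real_complex R)) -!rmorphM -rmorphN.
by congr (_%:C); ring.
Qed.

(** Each factor squares to the scalar 1 or -1, so its determinant squares to the [N]-th power of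
    that sign; the fourth power removes the sign. *)
Lemma spin_group_det G : spin_group sg Gam G -> \det G ^+ 4 = 1.
Proof.
case=> l [_ lq ->]; elim: l lq => [|v l IH] lq /=; first by rewrite det1 expr1n.
rewrite det_mulmx exprMn IH ?mulr1; last by move=> w wl; apply: lq; rewrite inE wl orbT.
have d2 : \det (cliff_vec Gam v) ^+ 2 = (- (quad sg v)%:C) ^+ N.
  by rewrite expr2 -det_mulmx cliff_vec_sqr det_scalar.
rewrite (exprM _ 2 2) d2 exprAC.
by case: (lq v); rewrite ?mem_head // => ->; rewrite ?rmorphN ?opprK ?sqrrN ?expr1n.
Qed.

End CliffordAlgebra.

(** * Vector fields and spin frames *)

Section VectorFields.
Variables (R : realType) (n : nat) (M : manifold R n).
Implicit Types (U V : set M) (X Y : M -> tvec M).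

Lemma vfield_sub U V X : V `<=` U -> vfield U X -> vfield V X.
Proof. by move=> VU [XT Xs]; split=> x /VU; [exact: XT|exact: Xs]. Qed.

Lemma tvec_sumE (I : finType) (v : I -> tvec M) (f : M -> R) :
  (\sum_i v i : tvec M) f = \sum_i (v i f : R).
Proof. by rewrite fct_sumE. Qed.

Lemma vfield_lincomb U (I : finType) (c : I -> M -> R) (E : I -> M -> tvec M) :
  (forall i x, U x -> smooth_at x (c i)) -> (forall i, vfield U (E i)) ->
  vfield U (fun y => \sum_i c i y *: E i y).
Proof.
move=> cs Ev; split=> x Ux.
  by apply: tangent_sum => i _; apply: tangentZ; apply: (Ev i).1.
move=> f fs; apply: (smooth_at_eq openT) (_ : smooth_at x
    (fun y => \sum_i c i y * (E i y f : R))) => //.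
  by move=> y _; rewrite tvec_sumE.
apply: smooth_at_sum => i _; apply: smooth_at_mul; first exact: cs.
exact: (Ev i).2.
Qed.

Variable g : metric M.

Lemma metricDl x u v w : tangent x u -> tangent x v -> tangent x w ->
  g x (u + v) w = g x u w + g x v w.
Proof. by move=> uT vT wT; have := metric_linear g 1 uT vT wT; rewrite scale1r mul1r. Qed.

Lemma metric0l x w : tangent x w -> g x 0 w = 0.
Proof.
move=> wT; apply: (addrI (g x 0 w)); rewrite addr0.
by rewrite -metricDl ?addr0 //; exact: tangent0.
Qed.

Lemma metric_sumZl x (I : finType) (c : I -> R) (v : I -> tvec M) w :
  (forall i, tangent x (v i)) -> tangent x w ->
  g x (\sum_i c i *: v i) w = \sum_i c i * g x (v i) w.
Proof.
move=> vT wT.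
have : tangent x (\sum_i c i *: v i) /\
    g x (\sum_i c i *: v i) w = \sum_i c i * g x (v i) w.
  elim/big_rec2: _ => [|i y u _ [uT <-]].
    by split; [exact: tangent0|exact: metric0l].
  by split; [exact: tangent_comb|rewrite metric_linear].
by case.
Qed.

End VectorFields.

(** * Orthonormal frames, Clifford multiplication and spinor fields *)

Section SpinFrames.
Variables (R : realType) (n : nat) (M : manifold R n) (g : metric M).
Variable s : spin_structure g.
Implicit Types (a b : sidx s) (x : M) (u v w : tvec M).

Local Notation et i := (eta R (@sgn _ _ _ _ s) i).

Lemma frame_tangent a i x : sdom a x -> tangent x (frame a i x).
Proof. exact: (frame_vfield a i).1. Qed.

Lemma metric_frame_comb a x (c : 'I_n -> R) j : sdom a x ->
  g x (\sum_i c i *: frame a i x) (frame a j x) = c j * et j.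
Proof.
move=> ax; rewrite metric_sumZl; last 2 first.
- by move=> i; exact: frame_tangent.
- exact: frame_tangent.
rewrite (bigD1 j) //= frame_orthonormal // eqxx mulr1n big1 ?addr0 // => i.
by move=> /negbTE ij; rewrite frame_orthonormal // ij mulr0n mulr0.
Qed.

Lemma frame_expand a x w : sdom a x -> tangent x w ->
  w = \sum_i (et i * g x w (frame a i x)) *: frame a i x.
Proof.
move=> ax wT; have [c wE] := frame_span ax wT.
rewrite {1}wE; apply: eq_bigr => i _; congr (_ *: _).
by rewrite wE metric_frame_comb // mulrCA eta_sqr mulr1.
Qed.

Definition gamma_mx a x w : 'M[R[i]]_(rk s) :=
  \sum_i (et i * g x w (frame a i x))%:C *: Gam s i.

Lemma gamma_mx_lincomb a x (I : finType) (c : I -> R) (v : I -> tvec M) :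
  sdom a x -> (forall i, tangent x (v i)) ->
  gamma_mx a x (\sum_i c i *: v i) = \sum_i (c i)%:C *: gamma_mx a x (v i).
Proof.
move=> ax vT; rewrite /gamma_mx; under [RHS]eq_bigr => k _ do rewrite scaler_sumr.
rewrite exchange_big /=; apply: eq_bigr => i _.
rewrite metric_sumZl //; last exact: frame_tangent.
rewrite mulr_sumr raddf_sum scaler_suml /=; apply: eq_bigr => k _.
by rewrite scalerA -rmorphM /=; congr (_%:C *: _); ring.
Qed.

Lemma gamma_mx_frame a i x : sdom a x -> gamma_mx a x (frame a i x) = Gam s i.
Proof.
move=> ax; rewrite /gamma_mx (bigD1 i) //= frame_orthonormal // eqxx mulr1n eta_sqr.
rewrite scale1r big1 ?addr0 // => j; rewrite eq_sym => /negbTE ij.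
by rewrite frame_orthonormal // ij mulr0n mulr0 scale0r.
Qed.

(** For the vectors of the frame [b] this is [trans_lift]; linearity in [w] gives the rest. It makes
    Clifford multiplication independent of the spin frame. *)
Lemma trans_gamma_mx a b x w : sdom a x -> sdom b x -> tangent x w ->
  trans a b x *m gamma_mx b x w = gamma_mx a x w *m trans a b x.
Proof.
move=> ax bx wT; rewrite {2}(frame_expand bx wT) gamma_mx_lincomb //; last first.
  by move=> i; exact: frame_tangent.
rewrite {1}/gamma_mx mulmx_sumr mulmx_suml; apply: eq_bigr => i _.
by rewrite -scalemxAl -scalemxAr trans_lift.
Qed.

Lemma trans_det a b x : sdom a x -> sdom b x -> \det (trans a b x) ^+ 4 = 1.
Proof. by move=> ax bx; exact/(spin_group_det (Gam_clifford s))/trans_spin. Qed.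

Lemma trans_unit a b x : sdom a x -> sdom b x -> trans a b x \in unitmx.
Proof.
move=> ax bx; rewrite unitmxE unitfE; apply: contra_eq_neq (trans_det ax bx).
by move=> ->; rewrite expr0n eq_sym oner_eq0.
Qed.

(** The cocycle relation makes the matrix idempotent, and an invertible idempotent is the
    identity. *)
Lemma trans_id a x : sdom a x -> trans a a x = 1%:M.
Proof.
move=> ax; have := trans_cocycle ax ax ax.
move=> /(congr1 (mulmx (invmx (trans a a x)))).
by rewrite mulKmx ?trans_unit // mulVmx ?trans_unit.
Qed.

Lemma trans_msmooth a b x : sdom a x -> sdom b x -> msmooth_at x (trans a b).
Proof. by move=> ax bx i j; exact: trans_smooth. Qed.

Lemma sfibZE (c : R[i]) (xi : sfib s) a : (c *: xi : sfib s) a = c *: xi a.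
Proof. by []. Qed.

Lemma sfibDE (xi zeta : sfib s) a : (xi + zeta : sfib s) a = xi a + zeta a.
Proof. by []. Qed.

Lemma sfib_sumE (I : finType) (z : I -> sfib s) a :
  (\sum_i z i : sfib s) a = \sum_i z i a.
Proof. by rewrite fct_sumE. Qed.

Lemma spinor0 x : spinor x (0 : sfib s).
Proof. by split=> [a b _ _|//]; rewrite mulmx0. Qed.

Lemma spinorZD x (c : R[i]) (xi zeta : sfib s) : spinor x xi -> spinor x zeta ->
  spinor x (c *: xi + zeta).
Proof.
move=> [xi1 xi2] [zeta1 zeta2]; split=> [a b ax bx|a nax].
  rewrite /GRing.add /GRing.scale /= (xi1 a b) // (zeta1 a b) //.
  by rewrite mulmxDr -scalemxAr.
by rewrite /GRing.add /GRing.scale /= xi2 // zeta2 // scaler0 addr0.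
Qed.

Lemma spinorZ x (c : R[i]) (xi : sfib s) : spinor x xi -> spinor x (c *: xi).
Proof. by move=> xiS; rewrite -[_ *: _]addr0; apply: spinorZD => //; exact: spinor0. Qed.

Lemma spinorD x (xi zeta : sfib s) : spinor x xi -> spinor x zeta ->
  spinor x (xi + zeta).
Proof. by move=> xiS ?; rewrite -[xi]scale1r; exact: spinorZD. Qed.

Lemma spinorB x (xi zeta : sfib s) : spinor x xi -> spinor x zeta ->
  spinor x (xi - zeta).
Proof. by move=> xiS ?; rewrite addrC -scaleN1r; exact: spinorZD. Qed.

Lemma spinor_eq a x (xi zeta : sfib s) : sdom a x -> spinor x xi ->
  spinor x zeta -> xi a = zeta a -> xi = zeta.
Proof.
move=> ax [xi1 xi2] [zeta1 zeta2] e; apply/funext => b.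
have [bx|nbx] := pselect (sdom b x); last by rewrite xi2 // zeta2.
by rewrite (xi1 b a) // (zeta1 b a) // e.
Qed.

Lemma gamma_spinor x w (xi : sfib s) : tangent x w -> spinor x xi ->
  spinor x (gamma x w xi).
Proof.
move=> wT [xi1 xi2]; split=> [a b ax bx|a nax]; rewrite /gamma.
  rewrite -/(gamma_mx a x w) -/(gamma_mx b x w) (xi1 a b) // !mulmxA.
  by rewrite trans_gamma_mx.
by rewrite xi2 // mulmx0.
Qed.

Lemma gamma_lincomb x (I : finType) (c : I -> R) (v : I -> tvec M) (xi : sfib s) :
  (forall i, tangent x (v i)) -> spinor x xi ->
  gamma x (\sum_i c i *: v i) xi = \sum_i (c i)%:C *: gamma x (v i) xi.
Proof.
move=> vT [_ xi0]; apply/funext => a; rewrite sfib_sumE.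
have [ax|nax] := pselect (sdom a x); last first.
  by rewrite [LHS]/gamma xi0 // mulmx0 big1 // => i _; rewrite sfibZE /gamma xi0 // mulmx0 scaler0.
rewrite [LHS]/gamma -/(gamma_mx a x _) gamma_mx_lincomb // mulmx_suml.
by apply: eq_bigr => i _; rewrite sfibZE -scalemxAl.
Qed.

Lemma gamma0 x w : gamma x w (0 : sfib s) = 0.
Proof. by apply/funext => a; rewrite /gamma mulmx0. Qed.

Lemma sfield_sub U V (psi : M -> sfib s) : V `<=` U -> sfield U psi ->
  sfield V psi.
Proof.
move=> VU [psi1 psi2]; split=> [x /VU|x a j /VU]; first exact: psi1.
exact: psi2.
Qed.

Lemma sfield_msmooth U (psi : M -> sfib s) a x : sfield U psi -> U x -> sdom a x ->
  msmooth_at x (fun y => psi y a).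
Proof. by move=> [_ psi2] Ux ax i j; rewrite ord1; exact: psi2. Qed.

Lemma gamma_mx_msmooth U (Y : M -> tvec M) a x : open U -> vfield U Y -> U x -> sdom a x ->
  msmooth_at x (fun y => gamma_mx a y (Y y)).
Proof.
move=> Uo Yv Ux ax; apply: msmooth_at_lincomb => i; apply: csmooth_at_real.
apply: smooth_at_mul; first exact: smooth_at_cst.
apply: (@metric_smooth _ _ _ g (U `&` sdom a) Y (frame a i)).
- by apply: openI => //; exact: sdom_open.
- by apply: vfield_sub Yv => y [].
- by apply: vfield_sub (frame_vfield a i) => y [].
- by split.
Qed.

Lemma gamma_sfield U (Y : M -> tvec M) (psi : M -> sfib s) : open U ->
  vfield U Y -> sfield U psi -> sfield U (fun y => gamma y (Y y) (psi y)).
Proof.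
move=> Uo Yv psiS; split=> [x Ux|x a j Ux ax].
  by apply: gamma_spinor; [exact: Yv.1|exact: psiS.1].
exact: (msmooth_at_mul (gamma_mx_msmooth Uo Yv Ux ax) (sfield_msmooth psiS Ux ax)).
Qed.

End SpinFrames.

(** * The spin connection is spinor-valued *)

(** Bookkeeping for the differentiated intertwining relation of spin frames: [B] is the term in the
    covariant derivative of a frame vector, common to both sides, and the inner differences come
    from commutators with the connection matrices. *)
Lemma zmod_cancel (V : zmodType) (B p q r t u w : V) :
  p + (B - (q - r)) = B - (t - u) + w -> p + t - q = w + u - r.
Proof.
rewrite addrCA -addrA => /addrI; rewrite !opprB => /(canRL (addrK _)) ->.
rewrite opprB !addrA (ACl (3*1*5*(2*6)*(4*7))) /=.
by rewrite addNr subrr !addr0.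
Qed.

Section SpinConnection.
Variables (R : realType) (n : nat) (M : manifold R n) (g : metric M).
Variable nab : M -> tvec M -> (M -> tvec M) -> tvec M.
Hypothesis hnab : levi_civita g nab.
Variable s : spin_structure g.
Implicit Types (a b : sidx s) (x : M) (u v w : tvec M) (U : set M).

Local Notation et i := (eta R (@sgn _ _ _ _ s) i).

(** The products [g(e_i, e_j)] are constant on [sdom a]; metric compatibility expands their
    vanishing derivative. *)
Lemma nab_frame_antisym a x v i j : sdom a x -> tangent x v ->
  g x (nab x v (frame a i)) (frame a j x) =
  - g x (nab x v (frame a j)) (frame a i x).
Proof.
move=> ax vT; have ao := sdom_open a.
have fi := frame_vfield a i; have fj := frame_vfield a j.
apply/eqP; rewrite -addr_eq0; apply/eqP.
have fjT := nab_tangent (lc_connection hnab) ao ax fj vT.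
rewrite [X in _ + X]Defs.metric_sym //; last exact: frame_tangent.
rewrite -(lc_metric hnab ao ax fi fj vT).
transitivity (v (fun=> et i *+ (i == j))); last exact: tangent_cst vT.
apply: (tangent_eq vT ao ax); first exact: (metric_smooth g ao fi fj).
by move=> y ay; rewrite frame_orthonormal.
Qed.

Definition spin_form a x v : 'M[R[i]]_(rk s) :=
  4^-1 *: \sum_i \sum_j
    (et i * et j * g x (nab x v (frame a i)) (frame a j x))%:C *:
    (Gam s i *m Gam s j).

Lemma snablaE a x v (psi : M -> sfib s) : sdom a x ->
  snabla nab x v psi a = dmx v (fun y => psi y a) + spin_form a x v *m psi x a.
Proof.
move=> ax; rewrite /snabla asboolT //; congr (_ + _).
by apply/matrixP => i j; rewrite !mxE ord1.
Qed.

(** Clifford multiplication is parallel: metric compatibility splits the derivative of [g(Y, e_i)],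
    and the part containing the derivative of [e_i] is minus the commutator with the connection
    matrix. *)
Lemma dmx_gamma_mx U (Y : M -> tvec M) a x v : open U -> vfield U Y -> U x ->
  sdom a x -> tangent x v ->
  dmx v (fun y => gamma_mx a y (Y y)) = gamma_mx a x (nab x v Y)
    - (spin_form a x v *m gamma_mx a x (Y x) - gamma_mx a x (Y x) *m spin_form a x v).
Proof.
move=> Uo Yv Ux ax vT; pose V := U `&` sdom a.
have Vo : open V by apply: openI => //; exact: sdom_open.
have Vx : V x by split.
have YV : vfield V Y by apply: vfield_sub Yv => y [].
have eV i : vfield V (frame a i) by apply: vfield_sub (frame_vfield a i) => y [].
have gs i := metric_smooth g Vo YV (eV i) Vx.
have YT : tangent x (Y x) by exact: Yv.1.
have nT i := nab_tangent (lc_connection hnab) Vo Vx (eV i) vT.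
rewrite (dmx_lincomb _ vT); last first.
  move=> i; apply: csmooth_at_real; apply: smooth_at_mul => //.
  exact: smooth_at_cst.
under eq_bigr => i _ do rewrite (cderiv_real _ vT) (tangent_scale _ vT) //
  (lc_metric hnab Vo Vx YV (eV i) vT) mulrDr rmorphD scalerDl.
rewrite big_split /=; congr (_ + _).
rewrite /gamma_mx mulmx_sumr mulmx_suml -sumrB -sumrN.
have commE k : spin_form a x v *m Gam s k - Gam s k *m spin_form a x v =
    \sum_j (et j * g x (nab x v (frame a k)) (frame a j x))%:C *: Gam s j.
  apply: (spin_connection_comm (Gam_clifford s)) => i j.
  exact: nab_frame_antisym.
under [RHS]eq_bigr => k _ do
  rewrite -scalemxAl -scalemxAr -scalerBr commE scaler_sumr -sumrN.
rewrite exchange_big /=; apply: eq_bigr => j _.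
(* Expanding [Y x] in the frame turns its product with the derivative of [e_j] into connection
   coefficients, whose indices antisymmetry then swaps. *)
rewrite {1}(frame_expand ax YT) metric_sumZl //; last first.
  by move=> i; exact: frame_tangent.
rewrite mulr_sumr raddf_sum scaler_suml; apply: eq_bigr => k _ /=.
rewrite scalerA -scaleNr -rmorphM -rmorphN; congr (_%:C *: _).
rewrite [g x (frame a k x) _]Defs.metric_sym //; last exact: frame_tangent.
by rewrite (nab_frame_antisym j k) //; ring.
Qed.

(* The defect [F] of the transformation law commutes with Clifford
   multiplication, hence is scalar, and it is trace-free because
   [\det (trans a b)] takes values in the fourth roots of unity. *)
Lemma trans_spin_form a b x v : sdom a x -> sdom b x -> tangent x v ->
  dmx v (trans a b) + spin_form a x v *m trans a b x =
  trans a b x *m spin_form b x v.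
Proof.
move=> ax bx vT; set T := trans a b x; set dT := dmx v _.
set Oa := spin_form a x v; set Ob := spin_form b x v.
pose V := sdom a `&` sdom b.
have Vo : open V by apply: openI; exact: sdom_open.
have Vx : V x by split.
have Ts := trans_msmooth ax bx.
have Tu : T \in unitmx by exact: trans_unit.
pose E := dT + Oa *m T - T *m Ob.
have EG k : E *m Gam s k = gamma_mx a x (frame b k x) *m E.
  have fv : vfield V (frame b k) by apply: vfield_sub (frame_vfield b k) => y [].
  have fT : tangent x (frame b k x) by exact: frame_tangent.
  have nT := nab_tangent (lc_connection hnab) Vo Vx fv vT.
  have sa := gamma_mx_msmooth Vo fv Vx ax; have sb := gamma_mx_msmooth Vo fv Vx bx.
  (* The intertwining relation holds on all of [V], so it may be differentiated; the two sides bring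
     in the connection matrices of [b] and [a]. *)
  have : dmx v (fun y => trans a b y *m gamma_mx b y (frame b k y)) =
         dmx v (fun y => gamma_mx a y (frame b k y) *m trans a b y).
    apply: (dmx_eq vT Vo Vx) => [|y [ay yb]]; first exact: msmooth_at_mul.
    by apply: trans_gamma_mx => //; exact: frame_tangent.
  rewrite (dmx_mul vT Ts sb) (dmx_mul vT sa Ts) (dmx_gamma_mx Vo fv Vx bx vT)
    (dmx_gamma_mx Vo fv Vx ax vT).
  rewrite -/T -/dT -/Oa -/Ob !mulmxBr !mulmxBl (trans_gamma_mx ax bx nT) -/T.
  rewrite gamma_mx_frame // => H.
  have TG : T *m Gam s k = gamma_mx a x (frame b k x) *m T.
    by rewrite -(gamma_mx_frame k bx) trans_gamma_mx.
  rewrite /E ?mulmxBl ?mulmxDl ?mulmxBr ?mulmxDr.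
  move: H; rewrite -!mulmxA TG !mulmxA TG; exact: zmod_cancel.
(* [E] intertwines [Gam s k] with its rotated image; [invmx T] undoes the rotation, so [F] lies in
   the commutant. *)
pose F := invmx T *m E.
have [c Fc] : exists c, F = c%:M.
  apply: (clifford_commutant (Gam_irreducible s)) => k.
  rewrite /F -mulmxA EG; rewrite mulmxA [RHS]mulmxA; congr (_ *m _).
  apply: (can_inj (mulKmx Tu)); rewrite mulKVmx // mulmxA.
  rewrite -(gamma_mx_frame k bx) (trans_gamma_mx ax bx (frame_tangent k bx)).
  by rewrite -mulmxA mulmxV // mulmx1.
have trO d : sdom d x -> \tr (spin_form d x v) = 0.
  move=> dx; apply: (spin_connection_tr (Gam_clifford s)) => i j.
  exact: nab_frame_antisym.
have trF : \tr F = 0.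
  (* By Jacobi's formula the constant [\det T ^+ 4] has derivative
     [4 * \det T ^+ 3 * \tr (dT *m \adj T)], and [invmx T] is a multiple of the adjugate. *)
  have dd : \tr (dT *m invmx T) = 0.
    have ds := csmooth_at_det Ts; pose d y := \det (trans a b y).
    have d4 : cderiv v (fun y => d y * d y * (d y * d y)) = 0.
      transitivity (cderiv v (fun=> 1)); last exact: cderiv_cst vT.
      apply: (cderiv_eq vT Vo Vx) => [|y [ay yb]].
        by apply: csmooth_at_mul; exact: csmooth_at_mul.
      by rewrite -(trans_det ay yb) /d; ring.
    move: d4; rewrite (cderiv_mul vT) ?(cderiv_mul vT ds ds); try exact: csmooth_at_mul.
    rewrite (cderiv_det vT Ts) -/dT -/T /d -/T => d4.
    have nz : 4 * \det T ^+ 3 != 0.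
      by rewrite mulf_neq0 ?expf_neq0 ?pnatr_eq0 // -unitfE -unitmxE.
    rewrite /invmx Tu -scalemxAr mxtraceZ.
    have /eqP : 4 * \det T ^+ 3 * \tr (dT *m \adj T) = 0 by rewrite -d4; ring.
    rewrite mulf_eq0 (negbTE nz) /=.
    by move=> /eqP ->; rewrite mulr0.
  rewrite /F /E mulmxBr mulmxDr mulKmx // raddfB raddfD /=.
  rewrite mxtrace_mulC dd mulmxA mxtrace_mulC mulmxA mulmxV // mul1mx.
  by rewrite !trO // subr0 addr0.
have E0 : E = 0.
  have -> : E = T *m F by rewrite mulKVmx.
  move: trF; rewrite Fc mxtrace_scalar => /eqP; rewrite mulrn_eq0.
  case: (Gam_irreducible s) => /lt0n_neq0 /negbTE -> _ /= /eqP ->.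
  by rewrite raddf0 mulmx0.
by apply/eqP; rewrite -subr_eq0 -/E E0 eqxx.
Qed.

(** Leibniz on [trans a b y *m psi y b] produces an inhomogeneous term [dmx v (trans a b)], which
    [trans_spin_form] absorbs. *)
Lemma snabla_spinor U (psi : M -> sfib s) x v : open U -> U x ->
  sfield U psi -> tangent x v -> spinor x (snabla nab x v psi).
Proof.
move=> Uo Ux psiS vT; split=> [a b ax bx|a nax]; last by rewrite /snabla asboolF.
rewrite !snablaE //; pose V := U `&` (sdom a `&` sdom b).
have Vo : open V by do 2?apply: openI => //; exact: sdom_open.
have Vx : V x by split.
have pb := sfield_msmooth psiS Ux bx.
have -> : dmx v (fun y => psi y a) = dmx v (fun y => trans a b y *m psi y b).
  apply: (dmx_eq vT Vo Vx) => [|y [Uy [ay yb]]]; first exact: sfield_msmooth psiS Ux ax.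
  exact: (psiS.1 y Uy).1.
rewrite (dmx_mul vT (trans_msmooth ax bx) pb) mulmxDr mulmxA.
rewrite -trans_spin_form // mulmxDl -mulmxA -((psiS.1 x Ux).1 a b ax bx).
by rewrite -!addrA addrCA.
Qed.

End SpinConnection.

(** * Difference of spinor connections *)

Lemma addr_idem0 (V : zmodType) (y : V) : y = y + y -> y = 0.
Proof. by rewrite -{1}[y]addr0 => /addrI. Qed.

Section SpinorConnections.
Variables (R : realType) (n : nat) (M : manifold R n) (g : metric M).
Variable nab : M -> tvec M -> (M -> tvec M) -> tvec M.
Hypothesis hnab : levi_civita g nab.
Variable s : spin_structure g.
Implicit Types (a b : sidx s) (x : M) (u v w : tvec M) (U : set M).
Implicit Types (sigma tau : M -> sfib s) (f : M -> R[i]) (xi zeta : sfib s).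

Lemma snabla_local U sigma tau x v : open U -> U x -> sfield U sigma ->
  tangent x v -> (forall y, U y -> sigma y = tau y) ->
  snabla nab x v sigma = snabla nab x v tau.
Proof.
move=> Uo Ux sS vT st; apply/funext => a.
have [ax|nax] := pselect (sdom a x); last by rewrite /snabla asboolF.
rewrite !snablaE // st //; congr (_ + _).
apply: (dmx_eq vT Uo Ux); first exact: sfield_msmooth sS Ux ax.
by move=> y Uy; rewrite st.
Qed.

Lemma snabla_add U sigma tau x v : U x -> sfield U sigma -> sfield U tau ->
  tangent x v ->
  snabla nab x v (fun y => sigma y + tau y) =
  snabla nab x v sigma + snabla nab x v tau.
Proof.
move=> Ux sS tS vT; apply/funext => a.
rewrite -[RHS]/(snabla nab x v sigma a + snabla nab x v tau a).
have [ax|nax] := pselect (sdom a x); last by rewrite /snabla asboolF // addr0.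
rewrite !snablaE //.
have -> : dmx v (fun y => (sigma y + tau y) a) =
    dmx v (fun y => sigma y a) + dmx v (fun y => tau y a).
  apply/matrixP => i j; rewrite !mxE -(cderiv_add vT).
  - by congr (cderiv v _); apply/funext => y; rewrite sfibDE mxE.
  - exact: (sfield_msmooth sS Ux ax).
  - exact: (sfield_msmooth tS Ux ax).
by rewrite mulmxDr addrACA.
Qed.

Lemma snabla_leibniz U f sigma x v : U x -> csmooth_at x f -> sfield U sigma ->
  tangent x v ->
  snabla nab x v (fun y => f y *: sigma y) =
  cderiv v f *: sigma x + f x *: snabla nab x v sigma.
Proof.
move=> Ux fs sS vT; apply/funext => a.
rewrite -[RHS]/(cderiv v f *: sigma x a + f x *: snabla nab x v sigma a).
have [ax|nax] := pselect (sdom a x); last first.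
  by rewrite /snabla asboolF // (sS.1 x Ux).2 // !scaler0 addr0.
rewrite !snablaE // sfibZE -scalemxAr scalerDr addrA; congr (_ + _).
apply/matrixP => i j; rewrite !mxE -(cderiv_mul vT fs).
  by congr (cderiv v _); apply/funext => y; rewrite sfibZE mxE.
exact: (sfield_msmooth sS Ux ax).
Qed.

Lemma sfield0 U : sfield U (fun=> 0 : sfib s).
Proof.
split=> [x _|x a j _ _]; first exact: spinor0.
by apply: (csmooth_at_eq openT) (csmooth_at_cst x 0) => // y _; rewrite mxE.
Qed.

Lemma sfieldD U sigma tau : sfield U sigma -> sfield U tau ->
  sfield U (fun y => sigma y + tau y).
Proof.
move=> sS tS; split=> [x Ux|x a j Ux ax].
  by apply: spinorD; [exact: sS.1|exact: tS.1].
have := csmooth_at_add (sS.2 x a j Ux ax) (tS.2 x a j Ux ax).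
by apply: (csmooth_at_eq openT) => // y _; rewrite sfibDE mxE.
Qed.

Lemma sfieldZ U f sigma : (forall x, U x -> csmooth_at x f) -> sfield U sigma ->
  sfield U (fun y => f y *: sigma y).
Proof.
move=> fs sS; split=> [x Ux|x a j Ux ax]; first by apply: spinorZ; exact: sS.1.
have := csmooth_at_mul (fs x Ux) (sS.2 x a j Ux ax).
by apply: (csmooth_at_eq openT) => // y _; rewrite sfibZE mxE.
Qed.

(** The local section with constant components [c] in the spin frame [a]; such sections extend every
    spinor smoothly. *)
Definition sconst a (c : 'cV[R[i]]_(rk s)) (y : M) : sfib s := fun b =>
  if `[< sdom b y >] then trans b a y *m c else 0.

Lemma sconst_spinor a c x : sdom a x -> spinor x (sconst a c x).
Proof.
move=> ax; split=> [b d bx dx|b nbx]; rewrite /sconst.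
  by rewrite !asboolT // mulmxA trans_cocycle.
by rewrite asboolF.
Qed.

Lemma sconst_self a c x : sdom a x -> sconst a c x a = c.
Proof. by move=> ax; rewrite /sconst asboolT // trans_id // mul1mx. Qed.

Lemma sconst_sfield a c : sfield (sdom a) (sconst a c).
Proof.
split=> [x ax|x b j ax bx]; first exact: sconst_spinor.
have := msmooth_at_mul (trans_msmooth bx ax) (msmooth_at_cst x c).
move=> /(_ j 0); apply: (csmooth_at_eq (sdom_open b) bx) => y yb.
by rewrite /sconst asboolT.
Qed.

Definition sframe a j : M -> sfib s := sconst a (delta_mx j 0).

Lemma sframe_expand a x xi : sdom a x -> spinor x xi ->
  xi = \sum_j xi a j 0 *: sframe a j x.
Proof.
move=> ax xiS; apply/funext => b; rewrite sfib_sumE.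
have [bx|nbx] := pselect (sdom b x); last first.
  rewrite xiS.2 // big1 // => j _.
  by rewrite sfibZE /sframe /sconst asboolF // scaler0.
rewrite (xiS.1 b a) // {1}[xi a]matrix_sum_delta mulmx_sumr.
apply: eq_bigr => j _; rewrite big_ord1 sfibZE /sframe /sconst asboolT //.
by rewrite -scalemxAr.
Qed.

Variable D : M -> tvec M -> (M -> sfib s) -> sfib s.
Hypothesis hD : spinor_connection D.

Local Notation diff x v sigma := (D x v sigma - snabla nab x v sigma).

Lemma diff_spinor U sigma x v : open U -> U x -> sfield U sigma ->
  tangent x v -> spinor x (diff x v sigma).
Proof.
move=> Uo Ux sS vT; apply: spinorB; first exact: (sconn_spinor hD Uo Ux).
exact: (snabla_spinor hnab Uo Ux sS vT).
Qed.

Lemma diff_add U sigma tau x v : open U -> U x -> sfield U sigma ->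
  sfield U tau -> tangent x v ->
  diff x v (fun y => sigma y + tau y) = diff x v sigma + diff x v tau.
Proof.
move=> Uo Ux sS tS vT; rewrite (sconn_add hD Uo Ux) // (snabla_add Ux) //.
by rewrite opprD addrACA.
Qed.

(** The derivative of [f] enters both connections alike and cancels, so the difference is linear
    over functions. *)
Lemma diff_scale U f sigma x v : open U -> U x ->
  (forall y, U y -> csmooth_at y f) -> sfield U sigma -> tangent x v ->
  diff x v (fun y => f y *: sigma y) = f x *: diff x v sigma.
Proof.
move=> Uo Ux fs sS vT; rewrite (sconn_leibniz hD Uo Ux) //.
rewrite (snabla_leibniz Ux (fs x Ux)) // scalerBr opprD addrACA.
by rewrite subrr add0r.
Qed.

Lemma diff0 x v : tangent x v -> diff x v (fun=> 0) = 0.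
Proof.
move=> vT; have := diff_add openT I (sfield0 setT) (sfield0 setT) vT.
have -> : (fun=> 0 + 0) = (fun=> 0) :> (M -> sfib s).
  by apply/funext => y; rewrite addr0.
exact: addr_idem0.
Qed.

Lemma diff_sum U (I : Type) (r : seq I) (f : I -> M -> R[i])
    (sigma : I -> M -> sfib s) x v :
  open U -> U x -> (forall i y, U y -> csmooth_at y (f i)) ->
  (forall i, sfield U (sigma i)) -> tangent x v ->
  sfield U (fun y => \sum_(i <- r) f i y *: sigma i y) /\
  diff x v (fun y => \sum_(i <- r) f i y *: sigma i y) =
  \sum_(i <- r) f i x *: diff x v (sigma i).
Proof.
move=> Uo Ux fs sS vT; elim: r => [|i r [IHs IH]].
  have -> : (fun y => \sum_(i <- [::]) f i y *: sigma i y) = fun=> 0.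
    by apply/funext => y; rewrite big_nil.
  by rewrite big_nil; split; [exact: sfield0|exact: diff0].
have -> : (fun y => \sum_(j <- i :: r) f j y *: sigma j y) =
    fun y => f i y *: sigma i y + \sum_(j <- r) f j y *: sigma j y.
  by apply/funext => y; rewrite big_cons.
have fsS : sfield U (fun y => f i y *: sigma i y).
  by apply: sfieldZ => // y; exact: fs.
split; first exact: sfieldD.
rewrite (diff_add Uo Ux fsS IHs vT) IH (diff_scale Uo Ux (fs i)) //.
by rewrite big_cons.
Qed.

(** After expansion in the spin frame near [x], linearity over functions leaves only the components
    at [x]. *)
Lemma diff_tensorial U sigma a x v : open U -> U x -> sdom a x ->
  sfield U sigma -> tangent x v ->
  diff x v sigma = \sum_j sigma x a j 0 *: diff x v (sframe a j).
Proof.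
move=> Uo Ux ax sS vT; pose V := U `&` sdom a.
have Vo : open V by apply: openI => //; exact: sdom_open.
have Vx : V x by split.
have sV : sfield V sigma by apply: sfield_sub sS => y [].
have eV j : sfield V (sframe a j).
  by apply: sfield_sub (sconst_sfield a (delta_mx j 0)) => y [].
have fV j y : V y -> csmooth_at y (fun z => sigma z a j 0).
  by move=> [Uy ay]; exact: sS.2.
have [tS <-] := diff_sum (index_enum _) Vo Vx fV eV vT.
have e y : V y -> sigma y = \sum_j sigma y a j 0 *: sframe a j y.
  by move=> [Uy ay]; apply: sframe_expand => //; exact: sS.1.
by rewrite (sconn_local hD Vo Vx sV tS vT e) (snabla_local Vo Vx sV vT e).
Qed.

(** Constant components in a spin frame give an extension, so the default of [sext] is not taken at
    a spinor. *)
Lemma sextP x xi : spinor x xi -> sext x xi x = xi /\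
  exists U, [/\ open U, U x & sfield U (sext x xi)].
Proof.
move=> xiS; have [a ax] := sdom_cover s x.
rewrite /sext; case: xgetP => [_ -> []//|/(_ (sconst a (xi a)))[]].
split; last by exists (sdom a); split; [exact: sdom_open| |exact: sconst_sfield].
apply: (spinor_eq ax) => //; first exact: sconst_spinor.
exact: sconst_self.
Qed.

Lemma conn_formE a x v xi : sdom a x -> tangent x v -> spinor x xi ->
  conn_form nab D x v xi = \sum_j xi a j 0 *: diff x v (sframe a j).
Proof.
move=> ax vT xiS; have [xiE [U [Uo Ux xS]]] := sextP xiS.
by rewrite /conn_form (diff_tensorial Uo Ux ax xS vT) xiE.
Qed.

(** Tensoriality lets any field with the right value at [x] replace the chosen extension. *)
Lemma conn_form_field U sigma x v : open U -> U x -> sfield U sigma ->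
  tangent x v -> conn_form nab D x v (sigma x) = diff x v sigma.
Proof.
move=> Uo Ux sS vT; have [a ax] := sdom_cover s x.
rewrite (conn_formE ax vT); last exact: sS.1.
by rewrite (diff_tensorial Uo Ux ax sS vT).
Qed.

Lemma conn_form_spinor x v xi : tangent x v -> spinor x xi ->
  spinor x (conn_form nab D x v xi).
Proof.
move=> vT /sextP[_ [U [Uo Ux xS]]]; exact: diff_spinor Uo Ux xS vT.
Qed.

Lemma conn_form_linear x v (c : R[i]) xi zeta : tangent x v -> spinor x xi ->
  spinor x zeta -> conn_form nab D x v (c *: xi + zeta) =
  c *: conn_form nab D x v xi + conn_form nab D x v zeta.
Proof.
move=> vT xiS zS; have [a ax] := sdom_cover s x.
rewrite !(conn_formE ax vT) //; last exact: spinorZD.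
rewrite scaler_sumr -big_split; apply: eq_bigr => j _ /=.
rewrite scalerA -scalerDl; congr (_ *: _).
by rewrite sfibDE sfibZE !mxE.
Qed.

End SpinorConnections.

(** * Charge conjugation and the bracket vector field *)

Section ChargeConjugation.
Variables (R : realType) (n : nat) (M : manifold R n) (g : metric M).
Variable nab : M -> tvec M -> (M -> tvec M) -> tvec M.
Hypothesis hnab : levi_civita g nab.
Variable s : spin_structure g.
Variable C : M -> sfib s -> sfib s -> R[i].
Hypothesis hC : charge_conjugation nab C.
Implicit Types (a b : sidx s) (x : M) (u v w : tvec M) (U : set M).
Implicit Types (sigma tau : M -> sfib s) (xi zeta chi : sfib s).

Lemma spinor_sum x (I : finType) (c : I -> R[i]) (z : I -> sfib s) :
  (forall i, spinor x (z i)) -> spinor x (\sum_i c i *: z i).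
Proof.
move=> zS; elim/big_rec: _ => [|i y _ yS]; first exact: spinor0.
exact: spinorZD.
Qed.

Lemma cc0r x xi : spinor x xi -> C x xi 0 = 0.
Proof.
move=> xiS; have := cc_linearr hC 1 (spinor0 s x) (spinor0 s x) xiS.
by rewrite scale1r addr0 mul1r; exact: addr_idem0.
Qed.

(** Linearity is available on spinors only, so the induction also carries that partial sums are
    spinors. *)
Lemma linear_spinor_sum (V : lmodType R[i]) (L : sfib s -> V) x (I : finType)
    (c : I -> R[i]) (z : I -> sfib s) :
  (forall (k : R[i]) xi zeta, spinor x xi -> spinor x zeta ->
     L (k *: xi + zeta) = k *: L xi + L zeta) ->
  (forall i, spinor x (z i)) ->
  L (\sum_i c i *: z i) = \sum_i c i *: L (z i).
Proof.
move=> LL zS; suff [] : spinor x (\sum_i c i *: z i) /\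
    L (\sum_i c i *: z i) = \sum_i c i *: L (z i) by [].
elim/big_rec2: _ => [|i y xi _ [xiS <-]].
  split; first exact: spinor0.
  have := LL 1 0 0 (spinor0 s x) (spinor0 s x).
  by rewrite !scale1r addr0; exact: addr_idem0.
by split; [exact: spinorZD|exact: LL].
Qed.

Lemma cc_sumr x chi (I : finType) (c : I -> R[i]) (z : I -> sfib s) :
  spinor x chi -> (forall i, spinor x (z i)) ->
  C x chi (\sum_i c i *: z i) = \sum_i c i * C x chi (z i).
Proof.
move=> chiS; apply: (linear_spinor_sum (V := R[i]^o) (L := C x chi)).
by move=> k xi zeta xiS zS; exact: (cc_linearr hC k xiS zS chiS).
Qed.

Lemma cc_suml x chi (I : finType) (c : I -> R[i]) (z : I -> sfib s) :
  spinor x chi -> (forall i, spinor x (z i)) ->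
  C x (\sum_i c i *: z i) chi = \sum_i c i * C x (z i) chi.
Proof.
move=> chiS; apply: (linear_spinor_sum (V := R[i]^o) (L := C x ^~ chi)).
by move=> k xi zeta xiS zS; exact: (cc_linearl hC k xiS zS chiS).
Qed.

Lemma ccBr x chi xi zeta : spinor x xi -> spinor x zeta -> spinor x chi ->
  C x chi (xi - zeta) = C x chi xi - C x chi zeta.
Proof.
move=> xiS zS chiS; rewrite addrC -scaleN1r (cc_linearr hC) //.
by rewrite mulN1r addrC.
Qed.

(** In a basis [e] of the fibre the adjoint solves a linear system with the Gram matrix [B] of [C],
    invertible because [C] is non-degenerate. *)
Lemma cadjP x (Phi : sfib s -> sfib s) xi : spinor x xi ->
  (forall chi, spinor x chi -> spinor x (Phi chi)) ->
  (forall (k : R[i]) chi zeta, spinor x chi -> spinor x zeta ->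
     Phi (k *: chi + zeta) = k *: Phi chi + Phi zeta) ->
  spinor x (cadj C x Phi xi) /\ forall chi, spinor x chi ->
    C x (cadj C x Phi xi) chi = C x xi (Phi chi).
Proof.
move=> xiS PhiS PhiL; have [a ax] := sdom_cover s x.
pose e j : sfib s := sframe a j x.
have eS j : spinor x (e j) by exact: sconst_spinor.
pose B : 'M[R[i]]_(rk s) := \matrix_(i, j) C x (e i) (e j).
have BE (r : 'rV[R[i]]_(rk s)) chi : spinor x chi ->
    C x (\sum_i r 0 i *: e i) chi = \sum_j chi a j 0 * (r *m B) 0 j.
  move=> chiS; rewrite {1}(sframe_expand ax chiS) cc_sumr //; last first.
    exact: spinor_sum.
  apply: eq_bigr => j _; rewrite (cc_suml _ (eS j) eS) mxE; congr (_ * _).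
  by apply: eq_bigr => i _; rewrite [B i j]mxE.
have Bu : B \in unitmx.
  (* A row killed by [B] gives a spinor orthogonal to all others, hence zero; its components in the
     frame [a] are the entries of the row. *)
  rewrite -row_free_unit; apply: inj_row_free => r rB.
  have zS : spinor x (\sum_i r 0 i *: e i) by exact: spinor_sum.
  have z0 : \sum_i r 0 i *: e i = 0.
    apply: (cc_nondeg hC zS) => chi chiS; rewrite BE // rB big1 // => j _.
    by rewrite mxE mulr0.
  have : (\sum_i r 0 i *: e i : sfib s) a = r^T.
    rewrite sfib_sumE; apply/matrixP => i j; rewrite ord1 summxE mxE (bigD1 i) //=.
    rewrite sfibZE /e /sframe sconst_self // !mxE !eqxx mulr1 big1 ?addr0 // => k.
    by rewrite sfibZE sconst_self // !mxE eq_sym => /negbTE ->; rewrite mulr0.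
  by rewrite z0 => /(congr1 trmx); rewrite trmxK trmx0.
rewrite /cadj; case: xgetP => [zeta -> []//|].
pose r : 'rV[R[i]]_(rk s) := (\row_j C x xi (Phi (e j))) *m invmx B.
move=> /(_ (\sum_i r 0 i *: e i)) []; split; first exact: spinor_sum.
move=> chi chiS; rewrite BE // /r mulmxKV //.
rewrite [in RHS](sframe_expand ax chiS) (linear_spinor_sum _ PhiL eS) cc_sumr //.
  by apply: eq_bigr => j _; rewrite mxE.
by move=> j; exact: PhiS.
Qed.

Variables phi psi : M -> sfib s.
Hypotheses (phiS : sfield setT phi) (psiS : sfield setT psi).

Local Notation et i := (eta R (@sgn _ _ _ _ s) i).

(** The index is raised in an orthonormal frame: the coefficient along [e_i] is [eta_i] times the
    component [c i], for real and imaginary parts separately. *)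
Lemma C1P x : ctangent x (C1 C phi psi x) /\ forall w, tangent x w ->
  cmetric g x (C1 C phi psi x) w = C x (phi x) (gamma x w (psi x)).
Proof.
have [a ax] := sdom_cover s x.
have phx := phiS.1 x I; have psx := psiS.1 x I.
pose c i : R[i] := C x (phi x) (gamma x (frame a i x) (psi x)).
pose u : ctvec M := fun f =>
  (\sum_i (et i * complex.Re (c i)) *: frame a i x : tvec M) f
  +i* (\sum_i (et i * complex.Im (c i)) *: frame a i x : tvec M) f.
rewrite /C1; case: xgetP => [_ -> []//|/(_ u)[]].
have fT i : tangent x (frame a i x) by exact: frame_tangent.
split; first by split; apply: tangent_sum => i _; exact: tangentZ.
move=> w wT.
rewrite [in RHS](frame_expand ax wT) gamma_lincomb // cc_sumr //; last first.
  by move=> i; exact: gamma_spinor.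
rewrite /cmetric; apply: complex_ext.
  rewrite raddf_sum /= metric_sumZl //; apply: eq_bigr => i _.
  by rewrite ReImE /= mul0r subr0 /c Defs.metric_sym //; ring.
rewrite raddf_sum /= metric_sumZl //; apply: eq_bigr => i _.
by rewrite ReImE /= mul0r addr0 /c Defs.metric_sym //; ring.
Qed.

(** [C1] is chosen point by point, but locally its frame coefficients [eta_i C(phi, gamma(e_i) psi)]
    are smooth. *)
Lemma C1_vfield : vfield setT (fun x => reT (C1 C phi psi x)) /\
  vfield setT (fun x => imT (C1 C phi psi x)).
Proof.
have key (p : R[i] -> R) (pT : ctvec M -> tvec M) :
    (forall x (u : ctvec M), ctangent x u -> tangent x (pT u)) ->
    (forall x (u : ctvec M) w, g x (pT u) w = p (cmetric g x u w)) ->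
    (forall x F, csmooth_at x F -> smooth_at x (fun y => p (F y))) ->
    vfield setT (fun x => pT (C1 C phi psi x)).
  move=> pTT pg ps; split=> x _; first exact/pTT/(C1P x).1.
  move=> f fs; have [a ax] := sdom_cover s x; have ao := sdom_open a.
  pose c i y := C y (phi y) (gamma y (frame a i y) (psi y)).
  have cv : vfield (sdom a) (fun y => \sum_i (et i * p (c i y)) *: frame a i y).
    apply: vfield_lincomb => [i y ay|i]; last exact: frame_vfield.
    apply: smooth_at_mul; first exact: smooth_at_cst.
    apply: ps; apply: (cc_smooth hC ao) => //.
      by apply: sfield_sub phiS.
    apply: gamma_sfield => //; first exact: frame_vfield.
    by apply: sfield_sub psiS.
  apply: (smooth_at_eq ao ax) (cv.2 x ax f fs) => y ay.
  have KT := pTT _ _ (C1P y).1.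
  rewrite [in RHS](frame_expand ay KT); congr (_ f).
  apply: eq_bigr => i _; congr (_ * _ *: _).
  by rewrite pg (C1P y).2 //; exact: frame_tangent.
split.
  apply: (key (@complex.Re R) (@reT R n M)) => //; first by move=> x u [].
  by move=> x F [].
apply: (key (@complex.Im R) (@imT R n M)) => //; first by move=> x u [].
by move=> x F [].
Qed.

Variable D : M -> tvec M -> (M -> sfib s) -> sfib s.
Hypothesis hD : spinor_connection D.
Hypothesis phi_par : forall x v, tangent x v -> conn_dual nab C D x v phi = 0.
Hypothesis psi_par : forall x v, tangent x v -> conn_dual nab C D x v psi = 0.

Lemma conn_hat_parallel (X Y : M -> tvec M) x : tangent x (X x) ->
  conn_hat nab C D (@gamma _ _ _ _ s) X Y psi x =
  D x (X x) (fun y => gamma y (Y y) (psi y)) - gamma x (nab x (X x) Y) (psi x).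
Proof. by move=> XT; rewrite /conn_hat psi_par // gamma0 subr0. Qed.

Lemma conn_hat_spinor U (X Y : M -> tvec M) x : open U -> vfield U X ->
  vfield U Y -> U x -> spinor x (conn_hat nab C D (@gamma _ _ _ _ s) X Y psi x).
Proof.
move=> Uo Xv Yv Ux; have XT := Xv.1 x Ux; rewrite conn_hat_parallel //.
have psiU : sfield U psi by apply: sfield_sub psiS.
apply: spinorB; first by apply: (sconn_spinor hD Uo Ux) => //; exact: gamma_sfield.
apply: gamma_spinor; last exact: psiS.1.
exact: (nab_tangent (lc_connection hnab) Uo Ux Yv XT).
Qed.

(* Since [D^C phi = 0], [C(nabla_v phi, .) = C(phi, (D - nabla)_v .)]; the
   derivative of [C(phi, sigma)] is thus [C(phi, D_v sigma)]. *)
Lemma cderiv_cc_parallel U sigma x v : open U -> U x -> sfield U sigma ->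
  tangent x v ->
  cderiv v (fun y => C y (phi y) (sigma y)) = C x (phi x) (D x v sigma).
Proof.
move=> Uo Ux sS vT; have phiU : sfield U phi by apply: sfield_sub phiS.
have phx := phiS.1 x I; have sx := sS.1 x Ux.
rewrite (cc_parallel hC Uo Ux) //.
have [aS aE] := cadjP phx (fun chi => conn_form_spinor hnab hD vT (xi := chi))
  (fun k chi zeta => conn_form_linear nab hD k vT (xi := chi) (zeta := zeta)).
have -> : snabla nab x v phi = cadj C x (conn_form nab D x v) (phi x).
  by apply/eqP; rewrite -subr_eq0; apply/eqP; exact: phi_par.
have nS := snabla_spinor hnab Uo Ux sS vT.
rewrite aE // (conn_form_field nab hD Uo Ux sS vT) ccBr ?subrK //.
exact: (sconn_spinor hD Uo Ux sS vT).
Qed.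

Lemma cnabla_C1 U (X Y : M -> tvec M) x : open U -> vfield U X ->
  vfield U Y -> U x ->
  cmetric g x (cnabla nab x (X x) (C1 C phi psi)) (Y x) =
  C x (phi x) (conn_hat nab C D (@gamma _ _ _ _ s) X Y psi x).
Proof.
move=> Uo Xv Yv Ux; have XT := Xv.1 x Ux.
have nT := nab_tangent (lc_connection hnab) Uo Ux Yv XT.
have psiU : sfield U psi by apply: sfield_sub psiS.
have phiU : sfield U phi by apply: sfield_sub phiS.
have gS := gamma_sfield Uo Yv psiU.
have [reV imV] := C1_vfield.
have {}reV : vfield U (fun y => reT (C1 C phi psi y)) by apply: vfield_sub reV.
have {}imV : vfield U (fun y => imT (C1 C phi psi y)) by apply: vfield_sub imV.
have dE : cderiv (X x) (fun y => cmetric g y (C1 C phi psi y) (Y y)) =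
    cmetric g x (cnabla nab x (X x) (C1 C phi psi)) (Y x)
    + cmetric g x (C1 C phi psi x) (nab x (X x) Y).
  apply: complex_ext; rewrite ReImE /=.
    exact: (lc_metric hnab Uo Ux reV Yv XT).
  exact: (lc_metric hnab Uo Ux imV Yv XT).
(* The same derivative, read through the defining property of [C1] as that of
   [C(phi, gamma(Y) psi)], to which parallelism of [phi] applies. *)
have dC : cderiv (X x) (fun y => cmetric g y (C1 C phi psi y) (Y y)) =
    C x (phi x) (D x (X x) (fun y => gamma y (Y y) (psi y))).
  rewrite -(cderiv_cc_parallel Uo Ux gS XT).
  apply/esym/(cderiv_eq XT Uo Ux); first exact: (cc_smooth hC Uo Ux).
  by move=> y Uy; rewrite (C1P y).2 //; exact: Yv.1.
rewrite conn_hat_parallel // ccBr.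
- by rewrite -dC dE (C1P x).2 // addrK.
- exact: (sconn_spinor hD Uo Ux gS XT).
- by apply: gamma_spinor => //; exact: psiS.1.
- exact: phiS.1.
Qed.

End ChargeConjugation.

(** * Killing fields *)

Section Killing.
Variables (R : realType) (n : nat) (M : manifold R n) (g : metric M).
Variable nab : M -> tvec M -> (M -> tvec M) -> tvec M.
Hypothesis hnab : levi_civita g nab.
Implicit Types (K X Y : M -> tvec M) (U : set M).

Lemma metricBl x (u v w : tvec M) : tangent x u -> tangent x v -> tangent x w ->
  g x (u - v) w = g x u w - g x v w.
Proof.
move=> uT vT wT; rewrite addrC -scaleN1r metric_linear //.
by rewrite mulN1r addrC.
Qed.

(** Writing [[K, X]] as [nabla_K X - nabla_X K] cancels the derivatives along [K] and leaves [(L_K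
    g)(X, Y) = g(nabla_X K, Y) + g(X, nabla_Y K)]. *)
Lemma killing_antisym K : vfield setT K ->
  (forall U X Y x, open U -> U x -> vfield U X -> vfield U Y ->
    g x (nab x (X x) K) (Y x) + g x (nab x (Y x) K) (X x) = 0) ->
  killing g K.
Proof.
move=> Kv Kanti; split=> // U X Y x Uo Ux Xv Yv.
have KU : vfield U K by apply: vfield_sub Kv.
have KT := Kv.1 x I; have XT := Xv.1 x Ux; have YT := Yv.1 x Ux.
have nT Z W : vfield U Z -> vfield U W -> tangent x (nab x (Z x) W).
  by move=> Zv Wv; apply: (nab_tangent (lc_connection hnab) Uo) => //; exact: Zv.1.
have nKX := nT _ _ KU Xv; have nXK := nT _ _ Xv KU.
have nKY := nT _ _ KU Yv; have nYK := nT _ _ Yv KU.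
rewrite (lc_metric hnab Uo Ux Xv Yv KT).
rewrite -(lc_torsion_free hnab Uo Ux KU Xv) -(lc_torsion_free hnab Uo Ux KU Yv).
rewrite metricBl // [X in _ - X]Defs.metric_sym //; last first.
  by rewrite -scaleN1r addrC; exact: tangent_comb.
rewrite metricBl // -(Kanti U X Y x Uo Ux Xv Yv).
by rewrite [g x (X x) _]Defs.metric_sym //; ring.
Qed.

(** The double is written as [K + K], so additivity of [nab] applies to the real and imaginary
    parts. *)
Lemma cnabla_double U (K : M -> ctvec M) x v (w : tvec M) : open U -> U x ->
  vfield U (fun y => reT (K y)) -> vfield U (fun y => imT (K y)) ->
  tangent x v -> tangent x w ->
  cmetric g x (cnabla nab x v (fun y f => 2 * K y f)) w =
  2 * cmetric g x (cnabla nab x v K) w.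
Proof.
move=> Uo Ux reV imV vT wT; have cn := lc_connection hnab.
have reT2 : (fun y => reT (fun f => 2 * K y f)) = fun y => reT (K y) + reT (K y).
  by apply/funext => y; apply/funext => f; rewrite /reT mulr_natl mulr2n ReD.
have imT2 : (fun y => imT (fun f => 2 * K y f)) = fun y => imT (K y) + imT (K y).
  by apply/funext => y; apply/funext => f; rewrite /imT mulr_natl mulr2n ImD.
rewrite mulr_natl mulr2n; apply: complex_ext; rewrite ReImE /=.
  rewrite -metricDl //; try exact: (nab_tangent cn Uo Ux reV vT).
  congr (g x _ w); rewrite -[reT _]/(nab x v (fun y => reT (fun f => 2 * K y f))) reT2.
  exact: (nab_add cn Uo Ux reV reV vT).
rewrite -metricDl //; try exact: (nab_tangent cn Uo Ux imV vT).
congr (g x _ w); rewrite -[imT _]/(nab x v (fun y => imT (fun f => 2 * K y f))) imT2.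
exact: (nab_add cn Uo Ux imV imV vT).
Qed.

Lemma ctvec_double_vfield U (K : M -> ctvec M) :
  vfield U (fun y => reT (K y)) -> vfield U (fun y => imT (K y)) ->
  vfield U (fun y => reT (fun f => 2 * K y f)) /\
  vfield U (fun y => imT (fun f => 2 * K y f)).
Proof.
have dbl (V : M -> tvec M) : vfield U V -> vfield U (fun y => V y + V y).
  move=> VV; have := vfield_lincomb (c := fun (_ : 'I_2) (_ : M) => 1)
    (E := fun=> V) (fun _ x _ => smooth_at_cst x 1) (fun=> VV).
  congr vfield; apply/funext => y.
  by rewrite big_ord_recl big_ord1 !scale1r.
move=> /dbl reV /dbl imV; split; [move: reV|move: imV]; congr vfield.
  by apply/funext => y; apply/funext => f; rewrite /reT mulr_natl mulr2n ReD.
by apply/funext => y; apply/funext => f; rewrite /imT mulr_natl mulr2n ImD.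
Qed.

End Killing.

(** * The Killing property of the bracket and its derivative in terms of the torsion *)

Unset Implicit Arguments.

Theorem theorem1 (R : realType) (n : nat) (M : manifold R n) (g : metric M)
  (nab : M -> tvec M -> (M -> tvec M) -> tvec M) (hnab : levi_civita g nab)
  (s : spin_structure g)
  (C : M -> sfib s -> sfib s -> R[i]) (hC : charge_conjugation nab C)
  (D : M -> tvec M -> (M -> sfib s) -> sfib s) (hD : spinor_connection D)
  (phi psi : M -> sfib s)
  (hphi : sfield setT phi) (hpsi : sfield setT psi)
  (hphi_par : forall x v, tangent x v -> conn_dual nab C D x v phi = 0)
  (hpsi_par : forall x v, tangent x v -> conn_dual nab C D x v psi = 0)
  (hsym : forall (U : set M) (X Y : M -> tvec M), open U ->
     vfield U X -> vfield U Y -> forall x, U x ->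
     conn_hat nab C D (@gamma _ _ _ _ s) X Y phi x
       + conn_hat nab C D (@gamma _ _ _ _ s) Y X phi x = 0 /\
     conn_hat nab C D (@gamma _ _ _ _ s) X Y psi x
       + conn_hat nab C D (@gamma _ _ _ _ s) Y X psi x = 0) :
  ckilling g (spinor_bracket C phi psi) /\
  forall (U : set M) (X Y : M -> tvec M), open U ->
    vfield U X -> vfield U Y -> forall x, U x ->
    cmetric g x (cnabla nab x (X x) (spinor_bracket C phi psi)) (Y x) =
    C x (phi x) (torsion nab C D X Y psi x).
Proof.
have [reV imV] := C1_vfield hC hphi hpsi.
have hatS := conn_hat_spinor hnab hpsi hD hpsi_par.
have nablaE (U : set M) (X Y : M -> tvec M) x : open U -> vfield U X ->
    vfield U Y -> U x ->
    cmetric g x (cnabla nab x (X x) (spinor_bracket C phi psi)) (Y x) =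
    2 * C x (phi x) (conn_hat nab C D (@gamma _ _ _ _ s) X Y psi x).
  move=> Uo Xv Yv Ux; have XT := Xv.1 x Ux; have YT := Yv.1 x Ux.
  rewrite (cnabla_double hnab openT I reV imV XT YT).
  by rewrite (cnabla_C1 hnab hC hphi hpsi hD hphi_par hpsi_par Uo).
(* The vanishing symmetric part on [psi] makes exchanging [X] and [Y] a change of sign. *)
have hatN (U : set M) (X Y : M -> tvec M) x : open U -> vfield U X ->
    vfield U Y -> U x -> conn_hat nab C D (@gamma _ _ _ _ s) Y X psi x =
    - conn_hat nab C D (@gamma _ _ _ _ s) X Y psi x.
  by move=> Uo Xv Yv Ux; apply/eqP; rewrite -addr_eq0 addrC (hsym U X Y Uo Xv Yv x Ux).2.
have [re2 im2] := ctvec_double_vfield reV imV.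
split; last first.
  (* The torsion on [psi] is now twice [conn_hat], matching the factor 2 of the bracket. *)
  move=> U X Y Uo Xv Yv x Ux; rewrite (nablaE U) // /torsion (hatN U X Y) // opprK.
  rewrite -[X in X + _]scale1r (cc_linearr hC) ?mul1r ?mulr_natl ?mulr2n //.
  - exact: (hatS U).
  - exact: (hatS U).
  - exact: hphi.1.
have anti (U : set M) (X Y : M -> tvec M) x : open U -> U x -> vfield U X ->
    vfield U Y ->
    cmetric g x (cnabla nab x (X x) (spinor_bracket C phi psi)) (Y x)
    + cmetric g x (cnabla nab x (Y x) (spinor_bracket C phi psi)) (X x) = 0.
  move=> Uo Ux Xv Yv; rewrite !(nablaE U) // (hatN U X Y) // -mulrDr.
  have hS := hatS U X Y x Uo Xv Yv Ux.
  rewrite -sub0r (ccBr hC (spinor0 s x) hS (hphi.1 x I)).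
  by rewrite (cc0r hC (hphi.1 x I)) sub0r subrr mulr0.
(* The real and imaginary parts of [anti] are the antisymmetry conditions for the two real
   fields. *)
split; apply: (killing_antisym hnab) => // U X Y x Uo Ux Xv Yv.
  by have := congr1 (@complex.Re R) (anti U X Y x Uo Ux Xv Yv); rewrite ReImE.
by have := congr1 (@complex.Im R) (anti U X Y x Uo Ux Xv Yv); rewrite ReImE.
Qed.
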